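(* In the $\mathcal{FF}^{PD}_g$-space with $g=\text{const}$, the square of the curvature tensor $\rho_{knij}$ of the angle-preserving connection is given by $$\rho^{knij}\rho_{knij}=a^{knij}a_{knij}+\frac2{S^2}\Bigl(\frac1{h^2}-1\Bigr)\,\zeta^l a_l{}^{nij}\,\zeta^h a_{hnij}.$$
   Context: $M$ is an $N$-dimensional manifold with Riemannian metric $a_{ij}(x)$ and a 1-form $b=b_i(x)y^i$ of unit length, $a_{ij}b^ib^j=1$, $b^i=a^{ij}b_j$. Let $g$ be a constant with $-2<g<2$ and $h=\sqrt{1-g^2/4}$. Put $v^i=y^i-bb^i$, $q=\sqrt{(a_{mn}-b_mb_n)y^my^n}$, $A=b+\frac12gq$, $B=b^2+gbq+q^2$, $f=\arccos(A/\sqrt B)\in[0,\pi]$, $\chi=f/h$, $J=e^{-\frac12g\chi}$. The $\mathcal{FF}^{PD}_g$-Finsleroid metric function is $K=\sqrt B\,J$; $g_{ij}=\frac12\partial^2K^2/\partial y^i\partial y^j$, $g^{ij}$ is its inverse, $C_{mnh}=\frac12\partial g_{mn}/\partial y^h$ and $C^n{}_{hk}=g^{nm}C_{mhk}$. Put $\varkappa=\frac1hK^{1-h}$, $\zeta^i(x,y)=\bigl[hv^i+(b+\frac12gq)b^i\bigr]\frac{J}{\varkappa h}$, $S^2=a_{ij}\zeta^i\zeta^j$, and let $(y^m_i)$ be the inverse of the matrix $(\partial\zeta^i/\partial y^m)$. With $a^i{}_{kn}(x)$ the Christoffel symbols of $a_{ij}$, the angle-preserving connection is $$N^m_n=-y^m_i\Bigl(\frac{\partial\zeta^i}{\partial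 x^n}+a^i{}_{kn}\zeta^k\Bigr),\qquad D^k{}_{nm}=-\frac{\partial N^k_n}{\partial y^m},$$ considered for $y\neq0$ with $q\ne0$. Let $d_i=\partial/\partial x^i+N^k_i\,\partial/\partial y^k$, $$M^n{}_{ij}=d_iN^n_j-d_jN^n_i,\qquad E_k{}^n{}_{ij}=d_iD^n{}_{jk}-d_jD^n{}_{ik}+D^m{}_{jk}D^n{}_{im}-D^m{}_{ik}D^n{}_{jm}.$$ The curvature tensor is $\rho_k{}^n{}_{ij}=E_k{}^n{}_{ij}-M^h{}_{ij}C^n{}_{hk}$, with $\rho_{knij}=g_{nm}\rho_k{}^m{}_{ij}$, and $\rho^{knij}=g^{kp}g^{nr}a^{is}a^{jt}\rho_{prst}$. The Riemannian curvature tensor of $a_{ij}$ is $$a_n{}^i{}_{km}=\frac{\partial a^i{}_{nm}}{\partial x^k}-\frac{\partial a^i{}_{nk}}{\partial x^m}+a^u{}_{nm}a^i{}_{uk}-a^u{}_{nk}a^i{}_{um},$$ and its indices are raised and lowered with $a_{ij}$ and its inverse. *)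

(* Defs.v *)
From HB Require Import structures.
From mathcomp Require Import all_boot all_order all_algebra.
From mathcomp Require Import all_classical all_reals all_analysis.
Set Implicit Arguments.
Unset Strict Implicit.
Unset Printing Implicit Defensive.
Import Order.TTheory GRing.Theory Num.Theory.
Import numFieldNormedType.Exports.
Local Open Scope classical_set_scope.
Local Open Scope ring_scope.

(* Points and tangent vectors in local coordinates are row vectors; [x 0 i] is
   the coordinate usually written with an upper index, x^i. *)

Section PartialDerivatives.
Context {R : realType} {N : nat}.
Implicit Types (F : 'rV[R]_N -> R) (U : set 'rV[R]_N).

Definition partial (i : 'I_N) F (x : 'rV[R]_N) : R :=
  'D_('e_i) F x.

(* U is meant to be open. *)
Fixpoint Ck (k : nat) U F : Prop :=
  {in U, continuous F} /\
  (if k is k'.+1 then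
     forall i : 'I_N,
       (forall x, U x -> derivable F x 'e_i) /\
       Ck k' U (partial i F)
   else True).

Definition smooth_on U F : Prop := forall k : nat, Ck k U F.

Definition jacobian_matrix (f : 'rV[R]_N -> 'rV[R]_N) (x : 'rV[R]_N) :
    'M[R]_N :=
  \matrix_(k, i) partial i (fun z => f z 0 k) x.

End PartialDerivatives.

Section Manifolds.
Context (R : realType) (N : nat).

Record chart (T : topologicalType) := Chart {
  chart_dom : set T;
  chart_map : T -> 'rV[R]_N;
  chart_inv : 'rV[R]_N -> T (* only relevant on the image of [chart_dom] *)
}.

Definition chart_img (T : topologicalType) (c : chart T) : set 'rV[R]_N :=
  chart_map c @` chart_dom c.

Definition is_chart (T : topologicalType) (c : chart T) : Prop :=
  [/\ open (chart_dom c),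
      open (chart_img c),
      {in chart_dom c, cancel (chart_map c) (chart_inv c)},
      {in chart_dom c, continuous (chart_map c)} &
      {in chart_img c, continuous (chart_inv c)}].

(* change of coordinates from c to c', and the open set of c-coordinates on
   which it is meaningful *)
Definition transition (T : topologicalType) (c c' : chart T) :
    'rV[R]_N -> 'rV[R]_N :=
  chart_map c' \o chart_inv c.

Definition overlap (T : topologicalType) (c c' : chart T) : set 'rV[R]_N :=
  chart_map c @` (chart_dom c `&` chart_dom c').

Record smoothManifold := SmoothManifold {
  mcarrier :> topologicalType;
  atlas : set (chart mcarrier);
  manifold_hausdorff : hausdorff_space mcarrier;
  manifold_second_countable : @second_countable mcarrier;
  atlas_charts : forall c, atlas c -> is_chart c;
  atlas_covers : forall p : mcarrier, exists2 c, atlas c & chart_dom c p;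
  atlas_compatible : forall c c', atlas c -> atlas c' ->
    forall k : 'I_N,
      smooth_on (overlap c c') (fun x => transition c c' x 0 k)
}.

(* Tensor fields are given by their components in each chart of the atlas; the
   last clause of each definition is the tensorial transformation law. *)
Record riemannian_metric (M : smoothManifold)
    (a : chart M -> 'rV[R]_N -> 'M[R]_N) : Prop := RiemannianMetric {
  metric_smooth : forall c, atlas c -> forall i j : 'I_N,
    smooth_on (chart_img c) (fun x => a c x i j);
  metric_symmetric : forall c, atlas c -> forall x, chart_img c x ->
    forall i j : 'I_N, a c x i j = a c x j i;
  metric_positive : forall c, atlas c -> forall x, chart_img c x ->
    forall y : 'rV[R]_N, y != 0 ->
      0 < \sum_i \sum_j a c x i j * y 0 i * y 0 j;
  metric_tensorial : forall c c', atlas c -> atlas c' ->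
    forall x, overlap c c' x ->
      a c x = (jacobian_matrix (transition c c') x)^T
              *m a c' (transition c c' x)
              *m jacobian_matrix (transition c c') x
}.

Record one_form (M : smoothManifold)
    (b : chart M -> 'rV[R]_N -> 'rV[R]_N) : Prop := OneForm {
  form_smooth : forall c, atlas c -> forall i : 'I_N,
    smooth_on (chart_img c) (fun x => b c x 0 i);
  form_tensorial : forall c c', atlas c -> atlas c' ->
    forall x, overlap c c' x ->
      b c x = b c' (transition c c' x) *m jacobian_matrix (transition c c') x
}.

End Manifolds.

Section Riemann.
Context {R : realType} {N : nat} (a : 'rV[R]_N -> 'M[R]_N).
Implicit Types (x : 'rV[R]_N) (i j k m n t u : 'I_N).

Definition ainv x : 'M[R]_N := invmx (a x).

(* christoffel x i k n = a^i_{kn} *)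
Definition christoffel x i k n : R :=
  2^-1 * \sum_u ainv x i u *
    (partial k (fun z => a z u n) x + partial n (fun z => a z u k) x
     - partial u (fun z => a z k n) x).

(* riemann x n i k m = a_n^i_{km} *)
Definition riemann x n i k m : R :=
  partial k (fun z => christoffel z i n m) x
  - partial m (fun z => christoffel z i n k) x
  + \sum_u christoffel x u n m * christoffel x i u k
  - \sum_u christoffel x u n k * christoffel x i u m.

(* riemann_low x k n i j = a_{knij} *)
Definition riemann_low x k n i j : R :=
  \sum_m a x n m * riemann x k m i j.

(* riemann_mix x k n i j = a_k^{nij} *)
Definition riemann_mix x k n i j : R :=
  \sum_u \sum_s \sum_t
    ainv x n u * ainv x i s * ainv x j t * riemann_low x k u s t.

(* riemann_up x k n i j = a^{knij} *)
Definition riemann_up x k n i j : R :=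
  \sum_m ainv x k m * riemann_mix x m n i j.

End Riemann.

Section Finsleroid.
Context {R : realType} {N : nat}.
Context (a : 'rV[R]_N -> 'M[R]_N) (b : 'rV[R]_N -> 'rV[R]_N) (g : R).
Implicit Types (x y : 'rV[R]_N) (i j k l m n r s t : 'I_N).
Implicit Types (F : 'rV[R]_N -> 'rV[R]_N -> R).

(* b^i *)
Definition bup x i : R := \sum_j ainv a x i j * b x 0 j.

Definition unit_length x : Prop :=
  \sum_i \sum_j a x i j * bup x i * bup x j = 1.

Definition hpar : R := Num.sqrt (1 - g ^+ 2 / 4).

(* the scalar b = b_i y^i *)
Definition bval x y : R := \sum_i b x 0 i * y 0 i.

Definition vvec x y i : R := y 0 i - bval x y * bup x i.

Definition qval x y : R :=
  Num.sqrt (\sum_m \sum_n (a x m n - b x 0 m * b x 0 n) * y 0 m * y 0 n).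

Definition Aval x y : R := bval x y + 2^-1 * g * qval x y.

Definition Bval x y : R :=
  bval x y ^+ 2 + g * bval x y * qval x y + qval x y ^+ 2.

Definition fval x y : R := acos (Aval x y / Num.sqrt (Bval x y)).

Definition chi x y : R := fval x y / hpar.

Definition Jval x y : R := expR (- (2^-1 * g * chi x y)).

Definition Kval x y : R := Num.sqrt (Bval x y) * Jval x y.

Definition partial_x i F x y : R := partial i (fun z => F z y) x.
Definition partial_y i F x y : R := partial i (F x) y.

Definition gmet x y : 'M[R]_N :=
  \matrix_(i, j)
    (2^-1 * partial_y i (partial_y j (fun x1 y1 => Kval x1 y1 ^+ 2)) x y).

Definition ginv x y : 'M[R]_N := invmx (gmet x y).

(* Cartan tensor: cartan m n k x y = C_{mnk}, cartan_up n l k x y = C^n_{lk} *)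
Definition cartan m n k x y : R :=
  2^-1 * partial_y k (fun x' y' => gmet x' y' m n) x y.

Definition cartan_up n l k x y : R := \sum_m ginv x y n m * cartan m l k x y.

Definition varkappa x y : R := hpar^-1 * Kval x y `^ (1 - hpar).

Definition zeta i x y : R :=
  (hpar * vvec x y i + (bval x y + 2^-1 * g * qval x y) * bup x i)
  * (Jval x y / (varkappa x y * hpar)).

Definition S2val x y : R :=
  \sum_i \sum_j a x i j * zeta i x y * zeta j x y.

(* the matrix (y^m_i), inverse of (d zeta^i / d y^m) *)
Definition zeta_inv x y : 'M[R]_N :=
  invmx (\matrix_(i, m) partial_y m (zeta i) x y).

(* Nconn m n x y = N^m_n *)
Definition Nconn m n x y : R :=
  - \sum_i zeta_inv x y m i *
      (partial_x n (zeta i) x y + \sum_k christoffel a x i k n * zeta k x y).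

(* Dconn k n m x y = D^k_{nm} *)
Definition Dconn k n m x y : R := - partial_y m (Nconn k n) x y.

Definition dhor i F x y : R :=
  partial_x i F x y + \sum_k Nconn k i x y * partial_y k F x y.

(* Mtens n i j x y = M^n_{ij} *)
Definition Mtens n i j x y : R :=
  dhor i (Nconn n j) x y - dhor j (Nconn n i) x y.

(* Etens k n i j x y = E_k^n_{ij} *)
Definition Etens k n i j x y : R :=
  dhor i (Dconn n j k) x y - dhor j (Dconn n i k) x y
  + \sum_m Dconn m j k x y * Dconn n i m x y
  - \sum_m Dconn m i k x y * Dconn n j m x y.

(* rho k n i j x y = rho_k^n_{ij} *)
Definition rho k n i j x y : R :=
  Etens k n i j x y - \sum_l Mtens l i j x y * cartan_up n l k x y.

(* rho_low k n i j x y = rho_{knij} *)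
Definition rho_low k n i j x y : R :=
  \sum_m gmet x y n m * rho k m i j x y.

(* rho_up k n i j x y = rho^{knij}: the first two indices are raised with the
   Finsler metric, the last two with the Riemannian one *)
Definition rho_up k n i j x y : R :=
  \sum_p \sum_r \sum_s \sum_t
    ginv x y k p * ginv x y n r * ainv a x i s * ainv a x j t
    * rho_low p r s t x y.

End Finsleroid.

(* Main.v *)
Require Import Defs.
From HB Require Import structures.
From mathcomp Require Import all_boot all_order all_algebra.
From mathcomp Require Import all_classical all_reals all_analysis.
From mathcomp Require Import ring lra.
Set Implicit Arguments.
Unset Strict Implicit.
Unset Printing Implicit Defensive.
Import Order.TTheory GRing.Theory Num.Theory.
Import numFieldNormedType.Exports.
Local Open Scope classical_set_scope.
Local Open Scope ring_scope.

(** Write [Z = zeta(x,y)] and let [P] be the Jacobian matrix of [Z] in [y].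
    The map [y |-> Z] turns the fibrewise geometry of the Finsleroid into
    Euclidean geometry, and everything follows from three facts about it.

    First, the Finsler metric is conformal to the pulled back Riemannian one,
    [g_ij = kappa^2 (P^T a P)_ij] ([metric_conformal]), where the logarithmic
    derivative of [kappa] in [y] is [(1/h - 1) / S^2] times the one-form
    [a(Z, dZ)] ([conformal_factor_vert]).  The reason is that
    [S = |Z|_a = K^h], so that [kappa] is a power of [S].

    Second, the connection is defined so that [d_j Z^l = - Gamma^l_kj Z^k]: in
    the coordinates [(x, Z)] it is the Levi-Civita connection of [a].  Since
    [[d_i, d_j] = M^n_ij d/dy^n] ([horizontal_commutator]), applying this
    commutator to [Z] gives [P M_ij = - R_ij Z] ([bracket_linear]), with [R_ij]
    the Riemannian curvature operator.  Moreover the tensor [E] is minus the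
    vertical derivative of [M] ([vertical_bracket]).

    Third, a Hessian metric has its Cartan tensor as Christoffel symbol of the
    first kind.  Hence [rho_ij] is the covariant derivative, for the metric
    [g] of the tangent space, of the vector field [v = - M_ij], which is the
    rotation field [R_ij Z] in the coordinates [Z].  The formula for a conformal
    change of a flat metric then yields, up to the factor [kappa^2] and to the
    change of basis [P],
      [rho_rs = R_rs + (1/h - 1) / S^2 (Z_r w_s - w_r Z_s)], [w_s = Z^m R_ms]
    ([conformal_covariant_derivative]); the skew-symmetry of [R_rs]
    ([riemann_skew]) removes the terms in [w(Z)].

    The conformal factors and [P] cancel in the square, and with [c = 1/h - 1]
    the cross terms give [4c/S^2] and the last one [2c^2/S^2] times [|w|^2],
    that is [2/S^2 ((1+c)^2 - 1)] in all ([conformal_square]).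

    The hypotheses provide smoothness through iterated partial derivatives, so
    the calculus below is directional: smooth functions are those with continuous
    iterated derivatives along a fixed family of vectors, and the symmetry of
    second derivatives ([schwarz]) is proved in that setting. *)

(** * Smooth functions *)

Section ChainRule.
Context {R : realType} {V : normedModType R}.
Implicit Types (f : V -> R) (p v : V).

(** Reduces chain rules and derivatives on product spaces to one real variable. *)
Lemma derive_line f p v : 'D_v f p = 'D_1 (fun t : R => f (t *: v + p)) 0.
Proof.
rewrite /derive; set g1 := fun h => h^-1 *: _; set g2 := fun h => h^-1 *: _.
suff -> : g1 = g2 by [].
by rewrite funeqE /g1 /g2 => h /=; rewrite addr0 scale0r add0r [_%:A]mulr1.
Qed.

Lemma is_derive_line f p v d :
  is_derive (0 : R) (1 : R) (fun t : R => f (t *: v + p)) d <->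
  is_derive p v f d.
Proof.
split=> -[H <-].
  by apply: DeriveDef; [exact/derivable1P|rewrite derive_line].
by apply: DeriveDef; [exact/(derivable1P f p v)|rewrite -derive_line].
Qed.

Lemma is_derive_chain (phi : R -> R) f p v d d' :
  is_derive (f p) 1 phi d -> is_derive p v f d' ->
  is_derive p v (fun q => phi (f q)) (d * d').
Proof.
move=> Hphi /is_derive_line Hf.
apply/is_derive_line.
apply: (@is_derive1_comp R phi (fun t : R => f (t *: v + p)) 0 d d') => //.
by rewrite scale0r add0r.
Qed.

End ChainRule.

Section SmoothFunctions.
Context {R : realType} {V : normedModType R} {I : Type}.
Context (e : I -> V) (U : set V).
Implicit Types (f : V -> R) (p : V) (i : I) (k : nat).

(** Derivatives are taken along the vectors [e i] only, so that no total
    differentiability has to be established. *)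
Fixpoint diffn k f : Prop :=
  (forall p, U p -> {for p, continuous f}) /\
  (if k is k'.+1 then
     forall i, (forall p, U p -> derivable f p (e i)) /\ diffn k' ('D_(e i) f)
   else True).

Definition smooth f : Prop := forall k, diffn k f.

Lemma diffn_continuous k f p : diffn k f -> U p -> {for p, continuous f}.
Proof. by case: k => [|k] [H _]; exact: H. Qed.

Lemma diffnW k f : diffn k.+1 f -> diffn k f.
Proof.
elim: k f => [|k IH] f [fc H]; split=> // i.
by have [fd dd] := H i; split=> //; exact: IH.
Qed.

Lemma smooth_continuous f p : smooth f -> U p -> {for p, continuous f}.
Proof. by move=> /(_ 0%N); exact: diffn_continuous. Qed.

Lemma smooth_derivable f i p : smooth f -> U p -> derivable f p (e i).
Proof. by move=> /(_ 1%N) [_ /(_ i) [+ _]]; exact. Qed.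

Lemma smooth_derive f i : smooth f -> smooth ('D_(e i) f).
Proof. by move=> sf k; have [_ /(_ i) []] := sf k.+1. Qed.

Lemma smooth_is_derive f i p :
  smooth f -> U p -> is_derive p (e i) f ('D_(e i) f p).
Proof. by move=> sf Up; apply/derivableP/smooth_derivable. Qed.

(** When the derivatives of [f] are expressions in [f] itself, its regularity
    improves by one order at a time. *)
Lemma diffn_bootstrap f :
  (forall p, U p -> {for p, continuous f}) ->
  (forall i p, U p -> derivable f p (e i)) ->
  (forall k i, diffn k f -> diffn k ('D_(e i) f)) -> smooth f.
Proof.
move=> fc fd H; elim=> [//|k IH]; split=> // i.
by split; [exact: fd|exact: H].
Qed.

Hypothesis oU : open U.

Lemma derive_eq_in f g i p : (forall q, U q -> f q = g q) -> U p ->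
  'D_(e i) f p = 'D_(e i) g p.
Proof.
move=> fg Up; apply: near_eq_derive.
by apply: filterS (open_nbhs_nbhs (conj oU Up)).
Qed.

Lemma is_derive_eq_in f g i p d : (forall q, U q -> f q = g q) -> U p ->
  is_derive p (e i) f d -> is_derive p (e i) g d.
Proof.
move=> fg Up; apply: near_eq_is_derive.
by apply: filterS (open_nbhs_nbhs (conj oU Up)).
Qed.

Lemma continuous_eq_in f g p : (forall q, U q -> f q = g q) -> U p ->
  {for p, continuous f} -> {for p, continuous g}.
Proof.
move=> fg Up fc; move: fc; rewrite /prop_for /continuous_at => fc.
rewrite -(fg p Up); apply: cvg_trans fc; apply: near_eq_cvg.
apply: filterS (open_nbhs_nbhs (conj oU Up)) => q Uq; exact: fg.
Qed.

Lemma diffn_eq_in k f g : (forall q, U q -> f q = g q) -> diffn k f -> diffn k g.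
Proof.
elim: k f g => [|k IH] f g fg [fc H]; split=> //;
  try by move=> p Up; apply: (continuous_eq_in fg) => //; exact: fc.
move=> i.
have [fd dd] := H i; split=> [p Up|].
  by have [] := is_derive_eq_in fg Up (derivableP (fd p Up)).
by apply: IH dd => q Uq; exact: derive_eq_in.
Qed.

Lemma smooth_eq_in f g : (forall q, U q -> f q = g q) -> smooth f -> smooth g.
Proof. by move=> fg sf k; exact: diffn_eq_in (sf k). Qed.

Lemma diffn_cst k (c : R) : diffn k (fun=> c).
Proof.
elim: k c => [|k IH] c; split=> //; try by move=> p _; exact: cst_continuous.
move=> i; split=> [p _|]; first exact: derivable_cst.
by apply: diffn_eq_in (IH 0) => q _; rewrite derive_cst.
Qed.

Lemma diffnD k f g : diffn k f -> diffn k g -> diffn k (fun p => f p + g p).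
Proof.
elim: k f g => [|k IH] f g [fc Hf] [gc Hg]; split=> //;
  try by move=> p Up; apply: cvgD; [exact: fc|exact: gc].
move=> i.
have [fd ddf] := Hf i; have [gd ddg] := Hg i; split=> [p Up|].
  by apply: derivableD; [exact: fd|exact: gd].
apply: diffn_eq_in (IH _ _ ddf ddg) => q Uq.
by rewrite (deriveD (fd q Uq) (gd q Uq)).
Qed.

Lemma diffnM k f g : diffn k f -> diffn k g -> diffn k (fun p => f p * g p).
Proof.
elim: k f g => [|k IH] f g Hf Hg; have [fc Hf'] := Hf; have [gc Hg'] := Hg;
    split=> //; try by move=> p Up; apply: cvgM; [exact: fc|exact: gc].
move=> i.
have [fd ddf] := Hf' i; have [gd ddg] := Hg' i; split=> [p Up|].
  by apply: derivableM; [exact: fd|exact: gd].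
apply: (@diffn_eq_in _ (fun p => f p * 'D_(e i) g p + g p * 'D_(e i) f p)).
  by move=> q Uq; rewrite (deriveM (fd q Uq) (gd q Uq)).
by apply: diffnD; apply: IH => //; exact: diffnW.
Qed.

Lemma smooth_cst (c : R) : smooth (fun=> c).
Proof. by move=> k; exact: diffn_cst. Qed.

Lemma smoothD f g : smooth f -> smooth g -> smooth (fun p => f p + g p).
Proof. by move=> sf sg k; exact: diffnD. Qed.

Lemma smoothM f g : smooth f -> smooth g -> smooth (fun p => f p * g p).
Proof. by move=> sf sg k; exact: diffnM. Qed.

Lemma smoothN f : smooth f -> smooth (fun p => - f p).
Proof.
move=> sf; apply: (@smooth_eq_in (fun p => (-1) * f p)) => [q _|].
  by rewrite mulN1r.
by apply: smoothM => //; exact: smooth_cst.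
Qed.

Lemma smoothB f g : smooth f -> smooth g -> smooth (fun p => f p - g p).
Proof. by move=> sf sg; apply: smoothD => //; exact: smoothN. Qed.

Lemma smoothX f n : smooth f -> smooth (fun p => f p ^+ n).
Proof.
move=> sf; elim: n => [|n IH].
  by apply: (@smooth_eq_in (fun=> 1)) => [q _|]; [rewrite expr0|exact: smooth_cst].
apply: (@smooth_eq_in (fun p => f p * f p ^+ n)) => [q _|]; first by rewrite exprS.
exact: smoothM.
Qed.

Lemma smooth_sum (J : Type) (r : seq J) (P : pred J) (F : J -> V -> R) :
  (forall j, smooth (F j)) -> smooth (fun p => \sum_(j <- r | P j) F j p).
Proof.
move=> sF; elim: r => [|j r IH].
  by apply: (@smooth_eq_in (fun=> 0)) => [q _|]; [rewrite big_nil|exact: smooth_cst].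
apply: (@smooth_eq_in (fun p => (if P j then F j p else 0) +
    \sum_(j <- r | P j) F j p)).
  by move=> q _; rewrite big_cons; case: (P j); rewrite ?add0r.
apply: smoothD IH; case: (P j) => //; exact: smooth_cst.
Qed.

Lemma smooth_prod (J : Type) (r : seq J) (P : pred J) (F : J -> V -> R) :
  (forall j, smooth (F j)) -> smooth (fun p => \prod_(j <- r | P j) F j p).
Proof.
move=> sF; elim: r => [|j r IH].
  by apply: (@smooth_eq_in (fun=> 1)) => [q _|]; [rewrite big_nil|exact: smooth_cst].
apply: (@smooth_eq_in (fun p => (if P j then F j p else 1) *
    \prod_(j <- r | P j) F j p)).
  by move=> q _; rewrite big_cons; case: (P j); rewrite ?mul1r.
apply: smoothM IH; case: (P j) => //; exact: smooth_cst.
Qed.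

(** Covers every [phi] whose derivative is as regular as [phi] along [f]: the
    derivatives of the composite are then at least as regular as the composite,
    and the bootstrap applies. *)
Lemma smooth_comp (phi dphi : R -> R) f :
  smooth f ->
  (forall p, U p -> {for f p, continuous phi}) ->
  (forall p, U p -> is_derive (f p) 1 phi (dphi (f p))) ->
  (forall k, diffn k (fun p => phi (f p)) -> diffn k (fun p => dphi (f p))) ->
  smooth (fun p => phi (f p)).
Proof.
move=> sf cphi dphiE H.
have D i p : U p -> is_derive p (e i) (fun q => phi (f q))
    (dphi (f p) * 'D_(e i) f p).
  move=> Up; apply: is_derive_chain; first exact: dphiE.
  exact: smooth_is_derive.
apply: diffn_bootstrap => [p Up|i p Up|k i Hk].
- by apply: continuous_comp; [exact: smooth_continuous|exact: cphi].
- by have [] := D i p Up.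
apply: (@diffn_eq_in _ (fun p => dphi (f p) * 'D_(e i) f p)).
  by move=> p Up; have [_ ->] := D i p Up.
by apply: diffnM; [exact: H|exact: smooth_derive].
Qed.

Lemma smoothV f : (forall p, U p -> f p != 0) -> smooth f ->
  smooth (fun p => (f p)^-1).
Proof.
move=> f0 sf; apply: (@smooth_comp (@GRing.inv R) (fun t => - (t^-1 * t^-1))) => //.
- by move=> p Up; apply: inv_continuous; exact: f0.
- move=> p Up.
  apply: (is_derive_eq (is_deriveV (f0 p Up) (is_derive_id (f p) 1))).
  by rewrite -expr2 exprVn; exact: mulr1.
- move=> k H.
  apply: (@diffn_eq_in _ (fun p => (-1) * ((f p)^-1 * (f p)^-1))).
    by move=> q _; rewrite mulN1r.
  by apply: diffnM; [exact: diffn_cst|exact: diffnM].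
Qed.

Lemma smooth_expR f : smooth f -> smooth (fun p => expR (f p)).
Proof.
move=> sf; apply: (@smooth_comp (@expR R) (@expR R)) => //.
by move=> p _; exact: continuous_expR.
Qed.

Lemma smooth_sqrt f : (forall p, U p -> 0 < f p) -> smooth f ->
  smooth (fun p => Num.sqrt (f p)).
Proof.
move=> f0 sf.
apply: (@smooth_comp Num.sqrt (fun t => (2 * Num.sqrt t)^-1)) => //.
- by move=> p _; exact: sqrt_continuous.
- by move=> p Up; apply: is_derive1_sqrt; exact: f0.
move=> k H.
apply: (@diffn_eq_in _ (fun p => 2^-1 * (Num.sqrt (f p) * (f p)^-1))).
  move=> q Uq; rewrite invfM; congr (_ * _).
  rewrite -[in (f q)^-1](sqr_sqrtr (ltW (f0 q Uq))) expr2 invfM mulrA divff ?mul1r//.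
  by rewrite gt_eqF// sqrtr_gt0 f0.
apply: diffnM; first exact: diffn_cst.
by apply: diffnM => //; apply: smoothV => // p Up; rewrite gt_eqF ?f0.
Qed.

Lemma smooth_ln f : (forall p, U p -> 0 < f p) -> smooth f ->
  smooth (fun p => ln (f p)).
Proof.
move=> f0 sf.
apply: (@smooth_comp (@ln R) (@GRing.inv R)) => //.
- by move=> p Up; apply: continuous_ln; exact: f0.
- by move=> p Up; apply: is_derive1_ln; exact: f0.
by move=> k _; apply: smoothV => // p Up; rewrite gt_eqF ?f0.
Qed.

Lemma smooth_acos f : (forall p, U p -> -1 < f p < 1) -> smooth f ->
  smooth (fun p => acos (f p)).
Proof.
move=> f0 sf.
have f1 p : U p -> 0 < 1 - f p ^+ 2.
  move=> /f0; nra.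
apply: (@smooth_comp (@acos R) (fun t => - (Num.sqrt (1 - t ^+ 2))^-1)) => //.
- by move=> p Up; apply: continuous_acos; exact: f0.
- by move=> p Up; apply: is_derive1_acos; exact: f0.
move=> k _; apply: smoothN; apply: smoothV.
  by move=> p Up; rewrite gt_eqF// sqrtr_gt0 f1.
apply: smooth_sqrt f1 _; apply: smoothB; [exact: smooth_cst|exact: smoothX].
Qed.

Lemma smooth_powR (c : R) f : (forall p, U p -> 0 < f p) -> smooth f ->
  smooth (fun p => f p `^ c).
Proof.
move=> f0 sf.
apply: (@smooth_eq_in (fun p => expR (c * ln (f p)))) => [p Up|].
  by rewrite /powR gt_eqF ?f0.
by apply: smooth_expR; apply: smoothM; [exact: smooth_cst|exact: smooth_ln].
Qed.

End SmoothFunctions.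

Lemma smooth_subset (R : realType) (V : normedModType R) (I : Type)
    (e : I -> V) (f : V -> R) (A B : set V) :
  A `<=` B -> smooth e B f -> smooth e A f.
Proof.
move=> AB sf k; elim: k f {sf}(sf k) => [|k IH] f [cf H].
  by split=> // p /AB; exact: cf.
split=> [p /AB|s]; first exact: cf.
by have [df /IH] := H s; split=> // p /AB; exact: df.
Qed.

Section MixedPartials.
Context {R : realType} {V : normedModType R} {I : Type}.
Context (e : I -> V) (U : set V).
Implicit Types (f : V -> R) (p : V) (i j : I).

Lemma is_derive_along f (u w : V) (s d : R) :
  is_derive (s *: u + w) u f d ->
  is_derive s 1 (fun t : R => f (t *: u + w)) d.
Proof.
move=> H; apply/is_derive_line.
suff -> : (fun t : R => f ((t *: 1 + s) *: u + w)) =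
          (fun t => f (t *: u + (s *: u + w))) by apply/is_derive_line.
by apply/funext => t; rewrite scalerDl [t *: 1]mulr1 addrA.
Qed.

Lemma mean_value_along f (g : V -> R) (u w : V) (h : R) : 0 < h ->
  (forall s, s \in `[0, h] -> is_derive (s *: u + w) u f (g (s *: u + w))) ->
  exists2 s, s \in `[0, h] & f (h *: u + w) - f w = g (s *: u + w) * h.
Proof.
move=> h0 H.
have D s : s \in `[0, h] ->
    is_derive s 1 (fun t => f (t *: u + w)) (g (s *: u + w)).
  by move=> /H; exact: is_derive_along.
have [|c cin E] := @MVT_segment R (fun t => f (t *: u + w))
    (fun t => g (t *: u + w)) 0 h (ltW h0) (fun s sin => D s (subset_itv_oo_cc sin)).
  by apply: derivable_within_continuous => s /D [].
by exists c => //; move: E; rewrite scale0r add0r subr0.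
Qed.

(** Mean value theorem in the direction [e i] for the increment of [f] along
    [e j], then in the direction [e j]. *)
Lemma second_difference f i j p (h : R) : smooth e U f -> 0 < h ->
  (forall s t : R, s \in `[0, h] -> t \in `[0, h] ->
     U (s *: e i + (t *: e j + p))) ->
  exists s t : R, [/\ s \in `[0, h], t \in `[0, h] &
    f (h *: e i + (h *: e j + p)) - f (h *: e i + p) - f (h *: e j + p) + f p
    = 'D_(e j) ('D_(e i) f) (t *: e j + (s *: e i + p)) * h * h].
Proof.
move=> sf h0 HU.
have z0 : (0 : R) \in `[0, h] by rewrite in_itv /= lexx ltW.
have hh : h \in `[0, h] by rewrite in_itv /= lexx ltW.
pose q : V := h *: e j.
have [|s sin E1] := @mean_value_along (fun w => f (w + q) - f w)
    (fun w => 'D_(e i) f (w + q) - 'D_(e i) f w) (e i) p h h0.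
  move=> s sin.
  have U1 : U (s *: e i + p).
    by have := HU s 0 sin z0; rewrite scale0r add0r.
  have U2 : U (s *: e i + p + q).
    by have := HU s h sin hh; rewrite [h *: e j + p]addrC addrA.
  have D1 := smooth_is_derive i sf U1.
  have D2 := smooth_is_derive i sf U2.
  apply: is_deriveB; apply/is_derive_line; move/is_derive_line: D2.
  suff -> : (fun t : R => f (t *: e i + (s *: e i + p + q))) =
    (fun t => f (t *: e i + (s *: e i + p) + q)) by [].
  by apply/funext => t; rewrite !addrA.
have [|t tin E2] := @mean_value_along ('D_(e i) f) ('D_(e j) ('D_(e i) f))
    (e j) (s *: e i + p) h h0.
  move=> t tin; apply: smooth_is_derive; first exact: smooth_derive.
  by rewrite addrCA; exact: HU.
exists s, t; split=> //.
rewrite -E2 -/q [q + (s *: e i + p)]addrC -E1.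
by rewrite [q + p]addrC [h *: e i + (p + q)]addrA; ring.
Qed.

Lemma small_square_in_ball p (u v : V) (r : R) : 0 < r ->
  exists2 h : R, 0 < h & forall s t : R, s \in `[0, h] -> t \in `[0, h] ->
    ball p r (s *: u + (t *: v + p)).
Proof.
move=> r0; pose M := `|u| + `|v| + 1.
have M0 : 0 < M by rewrite ltr_wpDl // addr_ge0.
exists (r / M); first exact: divr_gt0.
move=> s t; rewrite !in_itv /= => /andP[s0 sh] /andP[t0 th].
rewrite -ball_normE /= addrA opprD addrCA subrr addr0 normrN.
apply: le_lt_trans (ler_normD _ _) _; rewrite !normrZ !ger0_norm //.
apply: (@le_lt_trans _ _ (r / M * `|u| + r / M * `|v|)).
  by apply: lerD; apply: ler_wpM2r.
rewrite -mulrDr -mulrA gtr_pMr // mulrC ltr_pdivrMr // mul1r.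
by rewrite /M ltrDl.
Qed.

(** Both mixed derivatives are limits of the same second difference quotient. *)
Lemma schwarz f i j p : open U -> smooth e U f -> U p ->
  'D_(e j) ('D_(e i) f) p = 'D_(e i) ('D_(e j) f) p.
Proof.
move=> oU sf Up; apply/eqP; rewrite -subr_eq0 -normr_le0; apply/ler_addgt0Pl.
move=> eps eps0; rewrite addr0.
have near_val F : smooth e U F ->
    exists2 r, 0 < r & forall q, ball p r q -> U q /\ `|F p - F q| < eps / 2.
  move=> sF.
  have c2 : \forall q \near p, U q /\ `|F p - F q| < eps / 2.
    apply: filterI; first exact: open_nbhs_nbhs (conj oU Up).
    have /cvgrPdist_lt := smooth_continuous sF Up.
    by apply; rewrite divr_gt0.
  by move/nbhs_ballP: c2 => [r /= r0 H]; exists r.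
have [r1 r10 H1] := near_val _ (smooth_derive j (smooth_derive i sf)).
have [r2 r20 H2] := near_val _ (smooth_derive i (smooth_derive j sf)).
have r0 : 0 < Num.min r1 r2 by rewrite lt_min r10.
have [h h0 Hh] := small_square_in_ball p (e i) (e j) r0.
have ballW q : ball p (Num.min r1 r2) q -> ball p r1 q /\ ball p r2 q.
  move=> B; split; apply: le_ball B; rewrite ge_min lexx ?orbT //.
have [s [t [sin tin E1]]] : exists s t : R, [/\ s \in `[0, h], t \in `[0, h] &
    f (h *: e i + (h *: e j + p)) - f (h *: e i + p) - f (h *: e j + p) + f p
    = 'D_(e j) ('D_(e i) f) (t *: e j + (s *: e i + p)) * h * h].
  apply: second_difference => // s t sin tin.
  by have [/H1[]] := ballW _ (Hh s t sin tin).
have [t' [s' [tin' sin' E2]]] : exists t s : R, [/\ t \in `[0, h], s \in `[0, h] &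
    f (h *: e j + (h *: e i + p)) - f (h *: e j + p) - f (h *: e i + p) + f p
    = 'D_(e i) ('D_(e j) f) (s *: e i + (t *: e j + p)) * h * h].
  apply: second_difference => // t1 s1 tin1 sin1; rewrite addrCA.
  by have [/H1[]] := ballW _ (Hh s1 t1 sin1 tin1).
have [B1 _] := ballW _ (Hh s t sin tin).
have [_ B2] := ballW _ (Hh s' t' sin' tin').
have [_ L1] := H1 _ B1; have [_ L2] := H2 _ B2.
have E : 'D_(e j) ('D_(e i) f) (s *: e i + (t *: e j + p)) =
         'D_(e i) ('D_(e j) f) (s' *: e i + (t' *: e j + p)).
  have hn0 : h != 0 by rewrite gt_eqF.
  apply: (mulIf hn0); apply: (mulIf hn0) => /=.
  have -> : 'D_(e j) ('D_(e i) f) (s *: e i + (t *: e j + p)) =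
      'D_(e j) ('D_(e i) f) (t *: e j + (s *: e i + p)).
    by congr ('D_(e j) ('D_(e i) f) _); exact: addrCA.
  apply: (etrans (esym E1)); apply: (etrans _ E2).
  have -> : f (h *: e i + (h *: e j + p)) = f (h *: e j + (h *: e i + p)).
    by congr (f _); exact: addrCA.
  by congr (_ + _); exact: addrAC.
have close (x y z : R) : `|x - z| < eps / 2 -> `|y - z| < eps / 2 ->
    `|x - y| <= eps.
  move=> xz yz; rewrite [eps]splitr; apply: ltW.
  apply: le_lt_trans (ler_distD z _ _) _.
  by apply: ltrD => //; rewrite distrC.
by rewrite E in L1; exact: close L1 L2.
Qed.

End MixedPartials.

(** Sealed, so that comparing two derivatives never unfolds the limits that
    define them. *)
HB.lock Definition pderive {R : realType} {V : normedModType R} {I : Type}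
  (e : I -> V) (i : I) (f : V -> R) (p : V) : R := 'D_(e i) f p.

Section Rules.
Context {R : realType} {V : normedModType R} {I : Type}.
Context (e : I -> V) (U : set V).
Implicit Types (f g : V -> R) (p : V) (i j : I).
Local Notation smooth := (smooth e U).
Local Notation d := (pderive e).

Lemma pderiveE i f : d i f = 'D_(e i) f.
Proof. by rewrite pderive.unlock. Qed.

Lemma smooth_pderive i f : smooth f -> smooth (d i f).
Proof. by rewrite pderiveE; exact: smooth_derive. Qed.

Lemma pderive_val i f p c : is_derive p (e i) f c -> d i f p = c.
Proof. by rewrite pderiveE => -[]. Qed.

Lemma smooth_is_pderive i f p : smooth f -> U p -> is_derive p (e i) f (d i f p).
Proof. by rewrite pderiveE; exact: smooth_is_derive. Qed.

Lemma pderive_cst i p (c : R) : d i (fun=> c) p = 0.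
Proof. by rewrite pderiveE; exact: derive_cst. Qed.

Lemma pderiveD i f g p : smooth f -> smooth g -> U p ->
  d i (fun q => f q + g q) p = d i f p + d i g p.
Proof.
by move=> sf sg Up; rewrite !pderiveE; apply: deriveD; exact: smooth_derivable.
Qed.

Lemma pderiveN i f p : smooth f -> U p -> d i (fun q => - f q) p = - d i f p.
Proof.
by move=> sf Up; rewrite !pderiveE; apply: deriveN; exact: smooth_derivable.
Qed.

Lemma pderiveB i f g p : smooth f -> smooth g -> U p ->
  d i (fun q => f q - g q) p = d i f p - d i g p.
Proof.
by move=> sf sg Up; rewrite !pderiveE; apply: deriveB; exact: smooth_derivable.
Qed.

Lemma pderiveM i f g p : smooth f -> smooth g -> U p ->
  d i (fun q => f q * g q) p = d i f p * g p + f p * d i g p.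
Proof.
move=> sf sg Up; rewrite !pderiveE deriveM; try exact: smooth_derivable Up.
by rewrite addrC; congr (_ + _); exact: mulrC.
Qed.

Lemma pderiveZ i c f p : smooth f -> U p -> d i (fun q => c * f q) p = c * d i f p.
Proof.
by move=> sf Up; rewrite !pderiveE; apply: deriveMl; exact: smooth_derivable.
Qed.

Lemma pderive_comp i (phi : R -> R) f p c : is_derive (f p) 1 phi c ->
  smooth f -> U p -> d i (fun q => phi (f q)) p = c * d i f p.
Proof.
move=> Hphi sf Up; apply: pderive_val; apply: is_derive_chain => //.
exact: smooth_is_pderive.
Qed.

Hypothesis oU : open U.

Lemma pderive_eq_in i f g p : (forall q, U q -> f q = g q) -> U p ->
  d i f p = d i g p.
Proof. by move=> fg Up; rewrite !pderiveE; exact: (derive_eq_in e oU). Qed.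

Lemma pderiveC i j f p : smooth f -> U p -> d i (d j f) p = d j (d i f) p.
Proof. by move=> sf Up; rewrite !pderiveE; exact: (@schwarz _ _ _ e U). Qed.

Lemma pderive_sum i (J : Type) (r : seq J) (P : pred J) (F : J -> V -> R) p :
  (forall s, smooth (F s)) -> U p ->
  d i (fun q => \sum_(s <- r | P s) F s q) p = \sum_(s <- r | P s) d i (F s) p.
Proof.
move=> sF Up; elim: r => [|s r IH].
  rewrite big_nil -[RHS](pderive_cst i p 0).
  by apply: pderive_eq_in => // q _; rewrite big_nil.
rewrite big_cons -IH; case: ifP => Ps.
  rewrite -pderiveD //; last exact: smooth_sum.
  by apply: pderive_eq_in => // q _; rewrite big_cons Ps.
by apply: pderive_eq_in => // q _; rewrite big_cons Ps.
Qed.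

Lemma smooth_det n (A : V -> 'M[R]_n) :
  (forall k l, smooth (fun p => A p k l)) -> smooth (fun p => \det (A p)).
Proof.
move=> sA; rewrite /determinant; apply: (smooth_sum oU) => s.
by apply: (smoothM oU); [exact: smooth_cst|exact: (smooth_prod oU)].
Qed.

Lemma smooth_invmx n (A : V -> 'M[R]_n) :
  (forall k l, smooth (fun p => A p k l)) ->
  (forall p, U p -> A p \in unitmx) ->
  forall k l, smooth (fun p => invmx (A p) k l).
Proof.
move=> sA uA k l.
apply: (@smooth_eq_in _ _ _ _ _ oU (fun p => (\det (A p))^-1 *
    ((-1) ^+ (l + k) * \det (row' l (col' k (A p)))))) => [p Up|].
  by rewrite /invmx uA // !mxE /cofactor.
apply: (smoothM oU).
  apply: (smoothV oU); last exact: smooth_det.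
  by move=> p Up; have := uA p Up; rewrite unitmxE unitfE.
apply: (smoothM oU); first exact: smooth_cst.
apply: smooth_det => k' l'.
by apply: smooth_eq_in (sA (lift l k') (lift k l')) => // q _; rewrite !mxE.
Qed.

End Rules.

(** * Horizontal derivatives and the curvature of a nonlinear connection *)

(** Smoothness of polynomial expressions in derivatives of functions whose
    smoothness is known from the context. *)
Ltac prove_smooth :=
  lazymatch goal with
  | |- smooth _ _ (fun _ => ?c) => exact: smooth_cst
  | |- smooth _ _ (fun p => @?f p + @?g p) =>
      apply: smoothD; [assumption|prove_smooth|prove_smooth]
  | |- smooth _ _ (fun p => @?f p * @?g p) =>
      apply: smoothM; [assumption|prove_smooth|prove_smooth]
  | |- smooth _ _ (fun p => - @?f p) =>
      apply: smoothN; [assumption|prove_smooth]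
  | |- smooth _ _ (fun p => @?f p ^+ _) =>
      apply: smoothX; [assumption|prove_smooth]
  | |- smooth _ _ (fun p => \sum_(j <- _) _) =>
      apply: smooth_sum; [assumption|intro; prove_smooth]
  | |- smooth _ _ (pderive _ _ _) => apply: smooth_pderive; prove_smooth
  | |- smooth ?e ?U (fun p => ?f p) => change (smooth e U f); prove_smooth
  | |- _ => solve [auto with nocore]
  end.

Section HorizontalDerivatives.
Context {R : realType} {V : normedModType R} {N : nat}.
Context (e : 'I_N + 'I_N -> V) (W : set V).
Implicit Types (F G : V -> R) (p : V) (i j k m n : 'I_N).
Local Notation smooth := (smooth e W).
Local Notation d := (pderive e).
Local Notation dx i := (pderive e (inl i)).
Local Notation dy i := (pderive e (inr i)).
(** [Nc k i] is the coefficient N^k_i of a nonlinear connection: the vector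
    [inl i] is lifted by adding the vertical vectors [inr k]. *)
Context (Nc : 'I_N -> 'I_N -> V -> R).

Definition horizontal i F p : R := dx i F p + \sum_k Nc k i p * dy k F p.

Definition bracket n i j p : R :=
  horizontal i (Nc n j) p - horizontal j (Nc n i) p.

Hypotheses (oW : open W) (sN : forall k i, smooth (Nc k i)).

Lemma smooth_horizontal i F : smooth F -> smooth (horizontal i F).
Proof. move=> sF; rewrite /horizontal. prove_smooth. Qed.

Lemma smooth_bracket n i j : smooth (bracket n i j).
Proof.
by apply: smoothB => //; apply: smooth_horizontal.
Qed.

Lemma horizontal_eq_in i F G p : (forall q, W q -> F q = G q) -> W p ->
  horizontal i F p = horizontal i G p.
Proof.
move=> FG Wp; rewrite /horizontal (pderive_eq_in e oW _ FG Wp).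
by congr (_ + _); apply: eq_bigr => k _; rewrite (pderive_eq_in e oW _ FG Wp).
Qed.

Lemma horizontal_add i F G p : smooth F -> smooth G -> W p ->
  horizontal i (fun q => F q + G q) p = horizontal i F p + horizontal i G p.
Proof.
move=> sF sG Wp; rewrite /horizontal (pderiveD _ sF sG Wp) addrACA.
rewrite -big_split /=; congr (_ + _); apply: eq_bigr => k _.
by rewrite (pderiveD _ sF sG Wp) mulrDr.
Qed.

Lemma horizontal_opp i F p : smooth F -> W p ->
  horizontal i (fun q => - F q) p = - horizontal i F p.
Proof.
move=> sF Wp; rewrite /horizontal (pderiveN _ sF Wp) opprD -sumrN.
by congr (_ + _); apply: eq_bigr => k _; rewrite (pderiveN _ sF Wp) mulrN.
Qed.

Lemma horizontal_mul i F G p : smooth F -> smooth G -> W p ->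
  horizontal i (fun q => F q * G q) p =
  horizontal i F p * G p + F p * horizontal i G p.
Proof.
move=> sF sG Wp; rewrite /horizontal (pderiveM _ sF sG Wp) mulrDl mulrDr addrACA.
rewrite mulr_suml mulr_sumr -big_split /=; congr (_ + _); apply: eq_bigr => k _.
by rewrite (pderiveM _ sF sG Wp); ring.
Qed.

Lemma horizontal_sum (J : finType) i (F : J -> V -> R) p :
  (forall s, smooth (F s)) -> W p ->
  horizontal i (fun q => \sum_s F s q) p = \sum_s horizontal i (F s) p.
Proof.
move=> sF Wp; rewrite /horizontal (pderive_sum oW) //.
rewrite big_split /= exchange_big /=; congr (_ + _); apply: eq_bigr => k _.
by rewrite (pderive_sum oW) // mulr_sumr.
Qed.

Lemma vertical_horizontal k i F p : smooth F -> W p ->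
  dy k (horizontal i F) p =
  horizontal i (dy k F) p + \sum_m dy k (Nc m i) p * dy m F p.
Proof.
move=> sF Wp; rewrite /horizontal.
have sd s : smooth (d s F) by exact: smooth_pderive.
rewrite (@pderiveD _ _ _ e W _ (dx i F)) //; last by prove_smooth.
rewrite (pderiveC oW _ _ sF Wp) -addrA; congr (_ + _).
rewrite (pderive_sum oW) //; last by move=> m; prove_smooth.
rewrite -big_split /=; apply: eq_bigr => m _.
by rewrite (pderiveM _ (sN m i) (sd _) Wp) addrC (pderiveC oW _ _ sF Wp).
Qed.

(** The horizontal lifts of commuting fields commute up to a vertical field. *)
Lemma horizontal_commutator i j F p : smooth F -> W p ->
  horizontal i (horizontal j F) p - horizontal j (horizontal i F) p =
  \sum_k bracket k i j p * dy k F p.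
Proof.
move=> sF Wp.
have sd s : smooth (d s F) by exact: smooth_pderive.
(* The part of the second derivative in which the coefficients [Nc] are not
   differentiated; it is symmetric in the two directions. *)
pose sym i j := horizontal i (dx j F) p + \sum_k Nc k j p * horizontal i (dy k F) p.
have E a c : horizontal a (horizontal c F) p =
    sym a c + \sum_k horizontal a (Nc k c) p * dy k F p.
  rewrite /sym.
  rewrite -[LHS]/(horizontal a (fun q => dx c F q + \sum_k Nc k c q * dy k F q) p).
  rewrite horizontal_add //; last by prove_smooth.
  rewrite -[RHS]addrA; congr (_ + _).
  rewrite horizontal_sum //; last by move=> k; prove_smooth.
  rewrite -big_split /=; apply: eq_bigr => k _.
  by rewrite horizontal_mul // addrC.
have C s t : d s (d t F) p = d t (d s F) p.
  exact: (pderiveC oW).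
have S a c : sym a c = sym c a.
  have X b d : sym b d = dx b (dx d F) p +
      (\sum_k Nc k b p * dy k (dx d F) p + \sum_k Nc k d p * dx b (dy k F) p) +
      \sum_k \sum_m Nc k d p * (Nc m b p * dy m (dy k F) p).
    rewrite /sym /horizontal -!addrA; congr (_ + (_ + _)).
    rewrite -big_split /=; apply: eq_bigr => k _.
    by rewrite mulrDr mulr_sumr.
  apply: (etrans (X a c)); apply: (etrans _ (esym (X c a))).
  apply: (congr2 +%R (congr2 +%R _ _) _); first exact: C.
    apply: (etrans (addrC _ _)).
    by apply: (congr2 +%R _ _); apply: eq_bigr => k _; rewrite C.
  apply: (etrans (exchange_big _ _ _ _ _ _)) => /=.
  apply: eq_bigr => k _; apply: eq_bigr => m _.
  by rewrite mulrCA C.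
rewrite !E (S j i) opprD addrACA subrr add0r -sumrB.
by apply: eq_bigr => k _; rewrite /bracket mulrBl.
Qed.

(** The curvature of the linear connection with coefficients [- dN/dy] is minus
    the vertical derivative of the curvature of [N]. *)
Lemma vertical_bracket k n i j p : W p ->
  let D n j k q := - dy k (Nc n j) q in
  horizontal i (D n j k) p - horizontal j (D n i k) p
    + \sum_m D m j k p * D n i m p - \sum_m D m i k p * D n j m p
  = - dy k (bracket n i j) p.
Proof.
move=> Wp D; rewrite /D.
have sdN a c s : smooth (d s (Nc a c)) by exact: smooth_pderive.
rewrite !horizontal_opp //.
have -> : dy k (bracket n i j) p =
    dy k (horizontal i (Nc n j)) p - dy k (horizontal j (Nc n i)) p.
  rewrite (@pderiveD _ _ _ e W _ (horizontal i (Nc n j))) //; first last.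
  - by apply: smoothN => //; apply: smooth_horizontal.
  - exact: smooth_horizontal.
  by rewrite (@pderiveN _ _ _ e W) //; exact: smooth_horizontal.
rewrite !vertical_horizontal //.
under [X in _ + X - _]eq_bigr do rewrite mulrNN.
under [X in _ - X = _]eq_bigr do rewrite mulrNN.
ring.
Qed.

End HorizontalDerivatives.

(** * Connections that are linear in suitable fibre coordinates *)

Section LinearConnection.
Context {R : realType} {V : normedModType R} {N : nat}.
Context (e : 'I_N + 'I_N -> V) (W : set V).
Implicit Types (p : V) (i j k l m n u : 'I_N).
Local Notation smooth := (smooth e W).
Local Notation dx i := (pderive e (inl i)).
Local Notation dy i := (pderive e (inr i)).
Context (Nc : 'I_N -> 'I_N -> V -> R) (Z : 'I_N -> V -> R).
Context (Gam : 'I_N -> 'I_N -> 'I_N -> V -> R).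
Local Notation hor := (horizontal e Nc).

(** When the coefficients [Gam] do not vary vertically this is the curvature
    operator of the linear connection that they define. *)
Definition curvature k l i j p : R :=
  hor i (Gam l k j) p - hor j (Gam l k i) p
  + \sum_u Gam u k j p * Gam l u i p - \sum_u Gam u k i p * Gam l u j p.

(** The functions [Z] transform linearly under horizontal transport, so the
    commutator of two horizontal derivatives acts on them by the curvature. *)
Lemma bracket_linear : open W -> (forall k i, smooth (Nc k i)) ->
  (forall i, smooth (Z i)) -> (forall i k n, smooth (Gam i k n)) ->
  (forall i n p, W p -> hor n (Z i) p = - \sum_k Gam i k n p * Z k p) ->
  forall l i j p, W p ->
    \sum_n dy n (Z l) p * bracket e Nc n i j p = - \sum_k Z k p * curvature k l i j p.
Proof.
move=> oW sN sZ sG HZ l i j p Wp.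
under eq_bigr do rewrite mulrC.
rewrite -(horizontal_commutator oW sN _ _ (sZ l) Wp).
have E a c : hor a (hor c (Z l)) p =
    - \sum_k (hor a (Gam l k c) p * Z k p -
              Z k p * \sum_u Gam u k a p * Gam l u c p).
  rewrite (horizontal_eq_in e Nc oW a (HZ l c) Wp).
  rewrite (@horizontal_opp _ _ _ e W) //; last by prove_smooth.
  rewrite (horizontal_sum Nc oW) //; last by move=> k; prove_smooth.
  congr (- _); rewrite sumrB.
  under eq_bigr => k _ do rewrite (horizontal_mul Nc _ (sG l k c) (sZ k) Wp) HZ //.
  rewrite big_split /=; congr (_ + _).
  under eq_bigr do rewrite mulrN mulr_sumr.
  rewrite sumrN; congr (- _); rewrite exchange_big /=; apply: eq_bigr => k _.
  by rewrite mulr_sumr; apply: eq_bigr => u _; ring.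
rewrite !E -opprD -sumrB; congr (- _); apply: eq_bigr => k _.
by rewrite /curvature; ring.
Qed.

End LinearConnection.

Section FibreGeometry.
Context {R : realType} {V : normedModType R} {N : nat}.
Context (e : 'I_N + 'I_N -> V) (W : set V).
Implicit Types (p : V) (k l m n r s : 'I_N).
Local Notation smooth := (smooth e W).
Local Notation dy i := (pderive e (inr i)).
(** On each fibre [a] is constant and [Z] is a system of coordinates in which the
    metric [gm] is [kap2] times [a], while [v] is the linear vector field with
    matrix [Rm]. *)
Context (a : 'I_N -> 'I_N -> V -> R) (Z v : 'I_N -> V -> R) (kap2 : V -> R).
Context (gm Rm : 'I_N -> 'I_N -> V -> R) (c : R).

Local Notation P r n := (dy n (Z r)).

Definition zlow r p : R := \sum_s a r s p * Z s p.
Definition wlow r p : R := \sum_s a r s p * \sum_m Z m p * Rm m s p.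
Definition Rlow m r p : R := \sum_s a r s p * Rm m s p.

Hypotheses (oW : open W).
Hypotheses (sa : forall r s, smooth (a r s)) (sZ : forall r, smooth (Z r)).
Hypotheses (sv : forall r, smooth (v r)) (skap2 : smooth kap2).
Hypotheses (sRm : forall r s, smooth (Rm r s)).
Hypothesis a_sym : forall r s p, W p -> a r s p = a s r p.
Hypothesis a_vert : forall k r s p, W p -> dy k (a r s) p = 0.
Hypothesis Rm_vert : forall k r s p, W p -> dy k (Rm r s) p = 0.
Hypothesis gm_conformal : forall n l p, W p ->
  gm n l p = kap2 p * \sum_r \sum_s a r s p * (P r n p * P s l p).
Hypothesis gm_hessian : forall k n l p, W p ->
  dy k (gm n l) p = dy l (gm n k) p.
Hypothesis gm_sym : forall n l p, W p -> gm n l p = gm l n p.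
Hypothesis kap2_vert : forall k p, W p ->
  dy k kap2 p = 2 * c * kap2 p / (\sum_r Z r p * zlow r p) *
                \sum_r P r k p * zlow r p.
Hypothesis v_linear : forall l p, W p ->
  \sum_n P l n p * v n p = \sum_m Z m p * Rm m l p.
Hypothesis Rlow_skew : forall m r p, W p -> Rlow m r p = - Rlow r m p.

Let sP r n : smooth (P r n). Proof. exact: smooth_pderive. Qed.

Lemma wlowE r p : wlow r p = \sum_m Z m p * Rlow m r p.
Proof.
rewrite /wlow; under eq_bigr do rewrite mulr_sumr.
rewrite exchange_big /=; apply: eq_bigr => m _.
by rewrite mulr_sumr; apply: eq_bigr => s _; ring.
Qed.

Lemma wlow_ortho p : W p -> \sum_r Z r p * wlow r p = 0.
Proof.
move=> Wp; set x := LHS.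
have : x = - x.
  rewrite {1}/x; under eq_bigr do rewrite wlowE mulr_sumr.
  rewrite exchange_big /= /x -sumrN; apply: eq_bigr => r _.
  rewrite wlowE mulr_sumr -sumrN; apply: eq_bigr => s _.
  by rewrite (Rlow_skew r s Wp); ring.
by move=> /eqP; rewrite -addr_eq0 -mulr2n mulrn_eq0 /= => /eqP.
Qed.

(** The Christoffel symbol of the first kind of the flat metric [pullback]. *)
Definition flat_christoffel n k l p : R :=
  \sum_r \sum_s a r s p * (P r n p * dy k (P s l) p).

Lemma flat_christoffelC n k l p : W p -> flat_christoffel n k l p = flat_christoffel n l k p.
Proof.
move=> Wp; apply: eq_bigr => r _; apply: eq_bigr => s _.
by rewrite (pderiveC oW _ _ (sZ s) Wp).
Qed.

Definition pullback n l p : R := \sum_r \sum_s a r s p * (P r n p * P s l p).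

Lemma pullback_apply n (x : 'I_N -> R) p :
  \sum_l pullback n l p * x l =
  \sum_r P r n p * \sum_s a r s p * \sum_l P s l p * x l.
Proof.
rewrite /pullback; under eq_bigr do rewrite mulr_suml.
rewrite exchange_big /=; apply: eq_bigr => r _.
under eq_bigr do rewrite mulr_suml.
rewrite exchange_big /= mulr_sumr; apply: eq_bigr => s _.
by rewrite !mulr_sumr; apply: eq_bigr => l _; ring.
Qed.

Lemma gm_vert k n l p : W p ->
  dy k (gm n l) p = dy k kap2 p * pullback n l p
    + kap2 p * (flat_christoffel l k n p + flat_christoffel n k l p).
Proof.
move=> Wp; rewrite (pderive_eq_in e oW _ (gm_conformal n l) Wp).
rewrite (pderiveM (U := W)) //; last by prove_smooth.
congr (_ + _ * _).
rewrite (pderive_sum oW) //; last by move=> r; prove_smooth.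
rewrite /flat_christoffel [X in X + _]exchange_big -big_split /=; apply: eq_bigr => r _.
rewrite (pderive_sum oW) //; last by move=> s; prove_smooth.
rewrite -big_split /=; apply: eq_bigr => s _.
rewrite (pderiveM (U := W)) //; last by prove_smooth.
rewrite (pderiveM (U := W)) // a_vert // (a_sym s r Wp); ring.
Qed.

(** In a Hessian metric the Cartan tensor is the Christoffel symbol of the first
    kind, which is what makes a conformal change computable. *)
Lemma cartan_christoffel k n l p : W p ->
  2^-1 * dy k (gm n l) p = kap2 p * flat_christoffel n k l p
    + 2^-1 * (dy k kap2 p * pullback n l p + dy l kap2 p * pullback n k p
              - dy n kap2 p * pullback k l p).
Proof.
move=> Wp.
have E1 : dy l (gm n k) p = dy k (gm n l) p by rewrite gm_hessian.
have E2 : dy n (gm k l) p = dy k (gm n l) p.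
  rewrite (gm_hessian n k l Wp) (pderive_eq_in e oW _ (gm_sym k n) Wp).
  by rewrite gm_hessian.
have -> : dy k (gm n l) p =
    dy k (gm n l) p + dy l (gm n k) p - dy n (gm k l) p by rewrite E1 E2 addrK.
rewrite !gm_vert // (flat_christoffelC l n k Wp) (flat_christoffelC k n l Wp) (flat_christoffelC n l k Wp).
by field.
Qed.

(** The left side is the covariant derivative of [v] with lowered index. The flat
    Christoffel symbols cancel the second derivatives of [Z] produced by
    [v_linear], which leaves the matrix of the rotation; the derivative of the
    conformal factor adds the skew term, and its contraction with [v] vanishes
    because a rotation field is orthogonal to the position vector. *)
Lemma conformal_covariant_derivative k n p : W p ->
  \sum_m gm n m p * dy k (v m) p + \sum_l v l p * (2^-1 * dy k (gm n l) p) =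
  kap2 p * \sum_r \sum_s P r k p * P s n p *
    (Rlow r s p + c / (\sum_r Z r p * zlow r p) *
                  (zlow r p * wlow s p - wlow r p * zlow s p)).
Proof.
move=> Wp; set S2 := \sum_r Z r p * zlow r p.
have Pz b : dy b kap2 p = 2 * c * kap2 p / S2 * \sum_r P r b p * zlow r p.
  exact: kap2_vert.
have dlin : forall s, \sum_m P s m p * dy k (v m) p =
    \sum_m P m k p * Rm m s p - \sum_m dy k (P s m) p * v m p.
  move=> s; apply/eqP; rewrite eq_sym subr_eq addrC; apply/eqP.
  have := pderive_eq_in e oW (inr k) (v_linear s) Wp.
  rewrite (pderive_sum oW) //; last by move=> m; prove_smooth.
  rewrite (pderive_sum oW) //; last by move=> m; prove_smooth.
  under eq_bigr do rewrite (pderiveM (U := W)) //.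
  rewrite big_split /= => ->; apply: eq_bigr => m _.
  by rewrite (pderiveM (U := W)) // Rm_vert // mulr0 addr0.
have Hv b : \sum_l pullback b l p * v l p = \sum_r P r b p * wlow r p.
  rewrite pullback_apply; apply: eq_bigr => r _; congr (_ * _).
  by apply: eq_bigr => s _; rewrite v_linear.
(* The conformal factor is constant along the rotation field. *)
have kv : \sum_l dy l kap2 p * v l p = 0.
  under eq_bigr do rewrite Pz -mulrA mulr_suml.
  rewrite -mulr_sumr exchange_big /=.
  under [X in _ * X]eq_bigr => r _.
    under eq_bigr do rewrite mulrAC.
    rewrite -mulr_suml v_linear // /zlow mulr_sumr.
    over.
  rewrite (_ : \sum_r _ = 0) ?mulr0 // -[RHS](wlow_ortho Wp).
  rewrite exchange_big /=; apply: eq_bigr => s _.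
  rewrite mulr_sumr; apply: eq_bigr => r _.
  by rewrite (a_sym r s Wp); ring.
have -> : \sum_m gm n m p * dy k (v m) p =
    kap2 p * (\sum_r \sum_s P r k p * P s n p * Rlow r s p) -
    kap2 p * \sum_l v l p * flat_christoffel n k l p.
  under eq_bigr do rewrite gm_conformal // -/(pullback n _ p) -mulrA.
  rewrite -mulr_sumr -mulrBr pullback_apply; congr (_ * _).
  under eq_bigr do under eq_bigr do rewrite dlin mulrBr.
  under eq_bigr do rewrite sumrB mulrBr.
  rewrite sumrB; congr (_ - _).
    rewrite exchange_big /=; apply: eq_bigr => s _.
    under [RHS]eq_bigr do rewrite /Rlow mulr_sumr.
    rewrite exchange_big /= mulr_sumr; apply: eq_bigr => r _.
    by rewrite !mulr_sumr; apply: eq_bigr => m _; ring.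
  under [RHS]eq_bigr do rewrite /flat_christoffel mulr_sumr.
  rewrite [RHS]exchange_big /=; apply: eq_bigr => r _.
  under [RHS]eq_bigr do rewrite mulr_sumr.
  rewrite [RHS]exchange_big /= mulr_sumr; apply: eq_bigr => s _.
  by rewrite !mulr_sumr; apply: eq_bigr => m _; ring.
have -> : \sum_l v l p * (2^-1 * dy k (gm n l) p) =
    kap2 p * (\sum_l v l p * flat_christoffel n k l p) +
    2^-1 * (dy k kap2 p * (\sum_r P r n p * wlow r p) -
            dy n kap2 p * (\sum_r P r k p * wlow r p)).
  transitivity (\sum_l (kap2 p * (v l p * flat_christoffel n k l p) +
      2^-1 * ((dy k kap2 p * (pullback n l p * v l p) +
               pullback n k p * (dy l kap2 p * v l p)) -
              dy n kap2 p * (pullback k l p * v l p)))).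
    by apply: eq_bigr => l _; rewrite cartan_christoffel //; ring.
  rewrite big_split -!mulr_sumr sumrB big_split -!mulr_sumr /=.
  by rewrite !Hv kv mulr0 addr0.
rewrite !Pz.
have -> : \sum_r \sum_s P r k p * P s n p *
    (Rlow r s p + c / S2 * (zlow r p * wlow s p - wlow r p * zlow s p)) =
  \sum_r \sum_s P r k p * P s n p * Rlow r s p +
  c / S2 * ((\sum_r P r k p * zlow r p) * (\sum_s P s n p * wlow s p) -
            (\sum_r P r k p * wlow r p) * (\sum_s P s n p * zlow s p)).
  rewrite !big_distrlr /= -sumrB mulr_sumr -big_split /=; apply: eq_bigr => r _.
  rewrite -sumrB mulr_sumr -big_split /=; apply: eq_bigr => s _.
  by ring.
move: (S2^-1) => S2i.
by field.
Qed.

End FibreGeometry.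

(** * Trace algebra *)

Section TraceAlgebra.
Context {F : realFieldType} {N : nat}.
Implicit Types (A P T : 'M[F]_N).

Lemma invmx_unique A T : A *m T = 1%:M -> invmx A = T.
Proof.
move=> AT; have [uA _] := mulmx1_unit AT.
by rewrite -[RHS](mulKmx uA) AT mulmx1.
Qed.

(** Raising both indices with the pulled back metric undoes the pull back. *)
Lemma trace_pullback A P T1 T2 (kap : F) :
  A \in unitmx -> P \in unitmx -> kap != 0 ->
  let Gi := invmx (kap *: (P^T *m A *m P)) in
  \tr (Gi *m (kap *: (P^T *m T1 *m P)) *m Gi^T *m (kap *: (P^T *m T2 *m P))^T)
  = \tr (invmx A *m T1 *m (invmx A)^T *m T2^T).
Proof.
move=> uA uP kn0 Gi.
have uPt : P^T \in unitmx by rewrite unitmx_tr.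
have GiE : Gi = kap^-1 *: (invmx P *m invmx A *m invmx P^T).
  apply: invmx_unique; rewrite -scalemxAl -scalemxAr scalerA divff // scale1r.
  by rewrite !mulmxA mulmxK // mulmxK // mulmxV.
have GiT : Gi^T = kap^-1 *: (invmx P *m (invmx A)^T *m invmx P^T).
  by rewrite GiE linearZ /= !trmx_mul !trmx_inv trmxK !mulmxA.
have cancel B T : kap^-1 *: (invmx P *m B *m invmx P^T) *m
    (kap *: (P^T *m T *m P)) = invmx P *m (B *m T *m P).
  rewrite -scalemxAl -scalemxAr scalerA mulVf // scale1r.
  by rewrite !mulmxA mulmxKV.
have XT : (kap *: (P^T *m T2 *m P))^T = kap *: (P^T *m T2^T *m P).
  by rewrite linearZ /= !trmx_mul trmxK mulmxA.
rewrite GiT GiE XT cancel -mulmxA cancel.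
have -> : invmx P *m (invmx A *m T1 *m P) *m
    (invmx P *m ((invmx A)^T *m T2^T *m P)) =
    invmx P *m (invmx A *m T1 *m (invmx A)^T *m T2^T *m P).
  by rewrite !mulmxA mulmxK.
by rewrite mxtrace_mulC mulmxK.
Qed.

(** Here [w T] is orthogonal to [Z], since [T] is skew. So the added wedge
    products [z] with [w R1] and [z] with [w R2] have inner product
    [2 |Z|^2 (w R1, w R2)], and each has inner product [2 (w R1, w R2)] with the
    other skew matrix. *)
Lemma trace_skew A R1 R2 (Z : 'cV[F]_N) (c : F) :
  A \in unitmx -> A^T = A -> R1^T = - R1 -> R2^T = - R2 ->
  let z := A *m Z in let w T := T^T *m Z in
  let ext T := T + c *: (z *m (w T)^T - w T *m z^T) in
  \tr (invmx A *m ext R1 *m (invmx A)^T *m (ext R2)^T) =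
  \tr (invmx A *m R1 *m (invmx A)^T *m R2^T)
  + (4 * c + 2 * c ^+ 2 * \tr (Z^T *m A *m Z)) *
    \tr ((w R2)^T *m invmx A *m w R1).
Proof.
move=> uA sA sR1 sR2 z w ext.
have sAi : (invmx A)^T = invmx A by rewrite trmx_inv sA.
have Aiz : invmx A *m z = Z by rewrite mulKmx.
have ztAi : z^T *m invmx A = Z^T by rewrite -sAi -trmx_mul Aiz.
have wE T : T^T *m Z = w T by [].
have wT T : (w T)^T = Z^T *m T by rewrite trmx_mul trmxK.
have RZ T : T^T = - T -> T *m Z = - w T by move=> sT; rewrite /w sT mulNmx opprK.
have wZ T : T^T = - T -> (w T)^T *m Z = 0.
  move=> sT; rewrite wT; set x := LHS.
  have : x^T = - x.
    by rewrite /x !trmx_mul trmxK sT mulNmx mulmxN mulmxA.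
  rewrite [x]mx11_scalar tr_scalar_mx => /matrixP /(_ 0 0).
  rewrite !mxE eqxx mulr1n => /eqP.
  by rewrite -addr_eq0 -mulr2n mulrn_eq0 /= => /eqP ->; rewrite raddf0.
pose S2 := \tr (Z^T *m A *m Z).
have S2E : z^T *m Z = S2%:M.
  by rewrite trmx_mul sA [LHS]mx11_scalar /S2 trace_mx11.
have Ztz : Z^T *m z = S2%:M by rewrite -S2E /z trmx_mul sA mulmxA.
clearbody z w.
pose q := \tr ((w R2)^T *m invmx A *m w R1).
have qE : (w R2)^T *m invmx A *m w R1 = q%:M.
  by rewrite [LHS]mx11_scalar /q trace_mx11.
have qE' : (w R1)^T *m invmx A *m w R2 = q%:M.
  have -> : (w R1)^T *m invmx A *m w R2 = ((w R2)^T *m invmx A *m w R1)^T.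
    by rewrite !trmx_mul trmxK sAi mulmxA.
  by rewrite qE tr_scalar_mx.
rewrite sAi -/q -/S2.
have extT T : (ext T)^T = T^T + c *: (w T *m z^T - z *m (w T)^T).
  by rewrite /ext linearD /= linearZ /= linearB /= !trmx_mul !trmxK.
pose dy1 := z *m (w R1)^T - w R1 *m z^T.
pose dy2 := w R2 *m z^T - z *m (w R2)^T.
have tr11 (x : F) : \tr (x%:M : 'M[F]_1) = x by rewrite mxtrace_scalar.
have C1 : \tr (invmx A *m R1 *m invmx A *m dy2) = 2 * q.
  rewrite /dy2 mulmxBr linearB /= !mulmxA.
  have -> : \tr (invmx A *m R1 *m invmx A *m w R2 *m z^T) = q.
    rewrite mxtrace_mulC !mulmxA ztAi -wT qE'; exact: tr11.
  have -> : \tr (invmx A *m R1 *m invmx A *m z *m (w R2)^T) = - q.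
    rewrite mxtrace_mulC -[X in \tr (_ *m X)]mulmxA Aiz -[X in \tr (_ *m X)]mulmxA.
    by rewrite RZ // mulmxN mulmxN linearN /= mulmxA qE tr11.
  ring.
have C2 : \tr (invmx A *m dy1 *m invmx A *m R2^T) = 2 * q.
  rewrite /dy1 mulmxBr !mulmxBl linearB /= !mulmxA Aiz.
  have -> : \tr (Z *m (w R1)^T *m invmx A *m R2^T) = q.
    rewrite -!mulmxA mxtrace_mulC -!mulmxA wE mulmxA qE'; exact: tr11.
  have -> : \tr (invmx A *m w R1 *m z^T *m invmx A *m R2^T) = - q.
    rewrite -!mulmxA (mulmxA z^T) ztAi -trmx_mul RZ // linearN /= !mulmxN.
    by rewrite linearN /= mulmxA mxtrace_mulC mulmxA qE tr11.
  ring.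
have C3 : \tr (invmx A *m dy1 *m invmx A *m dy2) = 2 * q * S2.
  have -> : invmx A *m dy1 *m invmx A =
      Z *m ((w R1)^T *m invmx A) - invmx A *m w R1 *m Z^T.
    by rewrite /dy1 mulmxBr mulmxBl !mulmxA Aiz -[X in _ - X = _]mulmxA ztAi.
  have Zw : Z^T *m w R2 = 0 by rewrite -[LHS]trmxK trmx_mul trmxK wZ // trmx0.
  rewrite /dy2 mulmxBl !mulmxBr.
  have -> : Z *m ((w R1)^T *m invmx A) *m (w R2 *m z^T) = q *: (Z *m z^T).
    by rewrite -mulmxA [(w R1)^T *m invmx A *m _]mulmxA qE' mul_scalar_mx scalemxAr.
  have -> : Z *m ((w R1)^T *m invmx A) *m (z *m (w R2)^T) = 0.
    rewrite -!mulmxA (mulmxA (invmx A)) Aiz (mulmxA (w R1)^T) wZ //.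
    by rewrite mul0mx mulmx0.
  have -> : invmx A *m w R1 *m Z^T *m (w R2 *m z^T) = 0.
    by rewrite -mulmxA [Z^T *m _]mulmxA Zw mul0mx mulmx0.
  have -> : invmx A *m w R1 *m Z^T *m (z *m (w R2)^T) =
      S2 *: (invmx A *m w R1 *m (w R2)^T).
    by rewrite -mulmxA [Z^T *m _]mulmxA Ztz mul_scalar_mx scalemxAr.
  rewrite subr0 sub0r opprK linearD /= !linearZ /=.
  rewrite [\tr (Z *m z^T)]mxtrace_mulC S2E tr11.
  rewrite [\tr (invmx A *m w R1 *m (w R2)^T)]mxtrace_mulC mulmxA qE tr11.
  ring.
rewrite extT -/dy2 (_ : ext R1 = R1 + c *: dy1) //; clearbody dy1 dy2.
rewrite !(mulmxDr, mulmxDl) !linearD /=.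
rewrite !(=^~ scalemxAr, =^~ scalemxAl) !linearZ /= C1 C2 C3.
ring.
Qed.

Lemma trace_sandwich (G X Y : 'M[F]_N) :
  \tr (G *m X *m G^T *m Y^T) =
  \sum_k \sum_n (\sum_p \sum_r G k p * G n r * X p r) * Y k n.
Proof.
apply: eq_bigr => k _; rewrite mxE; apply: eq_bigr => n _; rewrite !mxE.
congr (_ * _); rewrite exchange_big /=; apply: eq_bigr => r _.
rewrite mxE mulr_suml mxE; apply: eq_bigr => p _.
by ring.
Qed.

Implicit Types X Y : 'I_N -> 'I_N -> 'M[F]_N.

(** The full contraction of two tensors with a pair of matrix indices and a pair
    of outer indices, raised by [G] and [B] respectively. *)
Definition pair_contraction (G B : 'M[F]_N) X Y : F :=
  \sum_i \sum_j \sum_s \sum_t B i s * B j t * \tr (G *m X s t *m G^T *m (Y i j)^T).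

Lemma pair_contractionE (G B : 'M[F]_N) (X Y : 'I_N -> 'I_N -> 'I_N -> 'I_N -> F) :
  \sum_k \sum_n \sum_i \sum_j
    (\sum_p \sum_r \sum_s \sum_t G k p * G n r * B i s * B j t * X p r s t)
    * Y k n i j =
  pair_contraction G B (fun s t => \matrix_(p, r) X p r s t)
                  (fun i j => \matrix_(k, n) Y k n i j).
Proof.
transitivity (\sum_k \sum_i \sum_j \sum_n
    (\sum_p \sum_r \sum_s \sum_t G k p * G n r * B i s * B j t * X p r s t)
    * Y k n i j).
  apply: eq_bigr => k _; rewrite exchange_big /=; apply: eq_bigr => i _.
  by rewrite exchange_big.
rewrite exchange_big /=; apply: eq_bigr => i _.
rewrite exchange_big /=; apply: eq_bigr => j _.
transitivity (\sum_k \sum_n \sum_s \sum_t B i s * B j t *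
    ((\sum_p \sum_r G k p * G n r * X p r s t) * Y k n i j)).
  apply: eq_bigr => k _; apply: eq_bigr => n _.
  under [in RHS]eq_bigr do under eq_bigr do rewrite mulrA.
  under [in RHS]eq_bigr do rewrite -mulr_suml.
  rewrite -mulr_suml; congr (_ * _).
  under [RHS]eq_bigr do under eq_bigr do rewrite mulr_sumr.
  under [RHS]eq_bigr do rewrite exchange_big /=.
  rewrite [RHS]exchange_big /=; apply: eq_bigr => p _.
  under [RHS]eq_bigr do under eq_bigr do rewrite mulr_sumr.
  under [RHS]eq_bigr do rewrite exchange_big /=.
  rewrite [RHS]exchange_big /=; apply: eq_bigr => r _.
  by apply: eq_bigr => s _; apply: eq_bigr => t _; ring.
under [LHS]eq_bigr do rewrite exchange_big /=.
rewrite [LHS]exchange_big /=; apply: eq_bigr => s _.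
under [LHS]eq_bigr do rewrite exchange_big /=.
rewrite [LHS]exchange_big /=; apply: eq_bigr => t _.
rewrite trace_sandwich mulr_sumr; apply: eq_bigr => k _.
rewrite mulr_sumr; apply: eq_bigr => n _; rewrite mxE; congr (_ * (_ * _)).
by apply: eq_bigr => p _; apply: eq_bigr => r _; rewrite mxE.
Qed.

End TraceAlgebra.

Section ConformalSquare.
Context {F : realFieldType} {N : nat}.
Context (A P : 'M[F]_N) (kap c : F) (Z : 'I_N -> F).
Context (Rl X : 'I_N -> 'I_N -> 'I_N -> 'I_N -> F).

Let ai : 'M[F]_N := invmx A.
Let z r := \sum_s A r s * Z s.
Let w s i j := \sum_m Z m * Rl m s i j.
Let S2 := \sum_r Z r * z r.

(** [P] is the Jacobian of a change of coordinates, [A] the flat metric, [Rl] a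
    tensor skew in its first two indices, and [X] is the pull back of [Rl]
    corrected by the wedge product of the position vector with its image. *)
Hypotheses (uA : A \in unitmx) (sA : A^T = A) (uP : P \in unitmx).
Hypotheses (kap_neq0 : kap != 0) (S2_neq0 : S2 != 0).
Hypothesis Rl_skew : forall k n i j, Rl k n i j = - Rl n k i j.
Hypothesis XE : forall k n i j, X k n i j = kap * \sum_r \sum_s P r k * P s n *
  (Rl r s i j + c / S2 * (z r * w s i j - w r i j * z s)).

Let Rmx i j := \matrix_(k, n) Rl k n i j.
Let Zv : 'cV[F]_N := \col_r Z r.

Let wE i j r : ((Rmx i j)^T *m Zv) r 0 = w r i j.
Proof.
by rewrite mxE; apply: eq_bigr => m _; rewrite !mxE mulrC.
Qed.

Let zE r : (A *m Zv) r 0 = z r.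
Proof. by rewrite mxE; apply: eq_bigr => m _; rewrite !mxE. Qed.

Let S2E : \tr (Zv^T *m A *m Zv) = S2.
Proof.
rewrite trace_mx11 -mulmxA mxE; apply: eq_bigr => r _.
by rewrite zE !mxE.
Qed.

Let XmxE i j : \matrix_(k, n) X k n i j = kap *: (P^T *m (Rmx i j + (c / S2) *:
  (A *m Zv *m ((Rmx i j)^T *m Zv)^T - (Rmx i j)^T *m Zv *m (A *m Zv)^T)) *m P).
Proof.
move: zE (wE i j).
move: (A *m Zv) ((Rmx i j)^T *m Zv) => u v uE vE.
apply/matrixP => k n; rewrite [LHS]mxE XE [RHS]mxE; congr (_ * _).
rewrite [LHS]exchange_big /= mxE; apply: eq_bigr => s _.
rewrite mxE mulr_suml; apply: eq_bigr => r _.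
by rewrite !mxE !big_ord1 !mxE !uE !vE; ring.
Qed.

Let square_mixed :
  \sum_n \sum_i \sum_j
    (\sum_l Z l * \sum_u \sum_s \sum_t ai n u * ai i s * ai j t * Rl l u s t)
    * (\sum_l Z l * Rl l n i j) =
  \sum_i \sum_j \sum_s \sum_t ai i s * ai j t *
    \tr (((Rmx i j)^T *m Zv)^T *m ai *m ((Rmx s t)^T *m Zv)).
Proof.
rewrite exchange_big /=; apply: eq_bigr => i _.
rewrite exchange_big /=; apply: eq_bigr => j _.
transitivity (\sum_n \sum_s \sum_t
    ai i s * ai j t * (w n i j * \sum_u ai n u * w u s t)).
  apply: eq_bigr => n _; rewrite -/(w n i j).
  have -> : \sum_l Z l * (\sum_u \sum_s \sum_t
      ai n u * ai i s * ai j t * Rl l u s t) =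
    \sum_s \sum_t ai i s * ai j t * \sum_u ai n u * w u s t.
    under eq_bigr do rewrite exchange_big mulr_sumr /=.
    rewrite exchange_big /=; apply: eq_bigr => s _.
    under eq_bigr do rewrite exchange_big mulr_sumr /=.
    rewrite exchange_big /=; apply: eq_bigr => t _.
    under eq_bigr do rewrite mulr_sumr.
    rewrite exchange_big /= mulr_sumr; apply: eq_bigr => u _.
    by rewrite !mulr_sumr; apply: eq_bigr => l _; ring.
  rewrite mulr_suml; apply: eq_bigr => s _.
  by rewrite mulr_suml; apply: eq_bigr => t _; ring.
rewrite exchange_big /=; apply: eq_bigr => s _.
rewrite exchange_big /=; apply: eq_bigr => t _.
rewrite -mulr_sumr; congr (_ * _); rewrite trace_mx11 -mulmxA mxE.
apply: eq_bigr => n _; rewrite mxE wE mxE; congr (_ * _).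
by apply: eq_bigr => u _; rewrite wE.
Qed.

(** Squares taken with the pulled back metric do not see [P] and [kap]; what is
    left is the trace computed in [trace_skew]. *)
Lemma conformal_square (Gi := invmx (kap *: (P^T *m A *m P))) :
  \sum_k \sum_n \sum_i \sum_j
    (\sum_p \sum_r \sum_s \sum_t
       Gi k p * Gi n r * ai i s * ai j t * X p r s t) * X k n i j =
  \sum_k \sum_n \sum_i \sum_j
    (\sum_m ai k m * \sum_u \sum_s \sum_t
       ai n u * ai i s * ai j t * Rl m u s t) * Rl k n i j
  + 2 / S2 * ((1 + c) ^+ 2 - 1) * \sum_n \sum_i \sum_j
    (\sum_l Z l * \sum_u \sum_s \sum_t ai n u * ai i s * ai j t * Rl l u s t)
    * (\sum_l Z l * Rl l n i j).
Proof.
rewrite pair_contractionE square_mixed.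
have -> : \sum_k \sum_n \sum_i \sum_j
    (\sum_m ai k m * \sum_u \sum_s \sum_t
       ai n u * ai i s * ai j t * Rl m u s t) * Rl k n i j = pair_contraction ai ai Rmx Rmx.
  rewrite -pair_contractionE; apply: eq_bigr => k _; apply: eq_bigr => n _.
  apply: eq_bigr => i _; apply: eq_bigr => j _; congr (_ * _).
  apply: eq_bigr => p _; rewrite mulr_sumr; apply: eq_bigr => r _.
  rewrite mulr_sumr; apply: eq_bigr => s _; rewrite mulr_sumr.
  by apply: eq_bigr => t _; ring.
rewrite /pair_contraction mulr_sumr -big_split /=; apply: eq_bigr => i _.
rewrite mulr_sumr -big_split /=; apply: eq_bigr => j _.
rewrite mulr_sumr -big_split /=; apply: eq_bigr => s _.
rewrite mulr_sumr -big_split /=; apply: eq_bigr => t _.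
rewrite !XmxE trace_pullback //.
have Rskew k l : (Rmx k l)^T = - Rmx k l.
  by apply/matrixP => m n; rewrite !mxE Rl_skew.
have := trace_skew Zv (c / S2) uA sA (Rskew s t) (Rskew i j).
rewrite /= S2E => ->.
rewrite -/ai; move: (\tr _) (\tr _) => u v.
by field.
Qed.

End ConformalSquare.

(** * The Finsleroid metric on one tangent space *)

Section FinsleroidFibre.
Context {R : realType} {V : normedModType R} {N : nat}.
Context (e : 'I_N + 'I_N -> V) (W : set V).
Implicit Types (p : V) (i j k l m n r s : 'I_N).
Local Notation smooth := (smooth e W).
Local Notation dy i := (pderive e (inr i)).
(** The metric, the one-form, its dual vector and the fibre coordinates, as
    functions on the total space; the first three are constant on each fibre. *)
Context (a : 'I_N -> 'I_N -> V -> R) (b bu y : 'I_N -> V -> R) (g h : R).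

Let beta p : R := \sum_i b i p * y i p.
Let Q2 p : R := \sum_m \sum_n (a m n p - b m p * b n p) * y m p * y n p.
Let q p : R := Num.sqrt (Q2 p).
Let A p : R := beta p + 2^-1 * g * q p.
Let B p : R := beta p ^+ 2 + g * beta p * q p + q p ^+ 2.
Let J p : R := expR (- (2^-1 * g * (acos (A p / Num.sqrt (B p)) / h))).
Let K p : R := Num.sqrt (B p) * J p.
Let kap p : R := h^-1 * K p `^ (1 - h).
Let Z i p : R := (h * (y i p - beta p * bu i p) + (beta p + 2^-1 * g * q p) * bu i p)
  * (J p / (kap p * h)).

Hypotheses (oW : open W) (Q2_gt0 : forall p, W p -> 0 < Q2 p).
Hypotheses (h_gt0 : 0 < h) (h2E : h ^+ 2 = 1 - g ^+ 2 / 4).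
Hypotheses (sa : forall i j, smooth (a i j)) (sb : forall i, smooth (b i)).
Hypotheses (sbu : forall i, smooth (bu i)) (sy : forall i, smooth (y i)).
Hypothesis a_sym : forall r s p, W p -> a r s p = a s r p.
Hypothesis a_vert : forall k r s p, W p -> dy k (a r s) p = 0.
Hypothesis b_vert : forall k r p, W p -> dy k (b r) p = 0.
Hypothesis bu_vert : forall k r p, W p -> dy k (bu r) p = 0.
Hypothesis y_vert : forall k r p, W p -> dy k (y r) p = (r == k)%:R.
Hypothesis bu_low : forall r p, W p -> \sum_s a r s p * bu s p = b r p.
Hypothesis bu_unit : forall p, W p -> \sum_r bu r p * b r p = 1.

Let u r p : R := \sum_s a r s p * y s p.

Let su r : smooth (u r). Proof. by rewrite /u; prove_smooth. Qed.
Let sbeta : smooth beta. Proof. by rewrite /beta; prove_smooth. Qed.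
Let sQ2 : smooth Q2.
Proof.
rewrite /Q2; apply: smooth_sum => // m; apply: smooth_sum => // n.
by prove_smooth.
Qed.
Let sq : smooth q. Proof. exact: smooth_sqrt. Qed.

Lemma delta_sum (F : 'I_N -> R) k : \sum_r (r == k)%:R * F r = F k.
Proof.
rewrite (bigD1 k) //= eqxx mul1r big1 ?addr0 // => r /negPf ->.
by rewrite mul0r.
Qed.

Let beta_vert k p : W p -> dy k beta p = b k p.
Proof.
move=> Wp; rewrite /beta (pderive_sum oW) //; last by move=> r; prove_smooth.
rewrite -[RHS](delta_sum (fun r => b r p)); apply: eq_bigr => r _.
by rewrite (pderiveM (U := W)) // b_vert // y_vert // mul0r add0r mulrC.
Qed.

Let u_vert k r p : W p -> dy k (u r) p = a r k p.
Proof.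
move=> Wp; rewrite /u (pderive_sum oW) //; last by move=> s; prove_smooth.
rewrite -[RHS](delta_sum (fun s => a r s p)); apply: eq_bigr => s _.
by rewrite (pderiveM (U := W)) // a_vert // y_vert // mul0r add0r mulrC.
Qed.

Let Q2E p : Q2 p = \sum_r y r p * u r p - beta p ^+ 2.
Proof.
rewrite /Q2 expr2 {2}/beta mulr_suml -sumrB; apply: eq_bigr => r _.
rewrite /u /beta !mulr_sumr -sumrB; apply: eq_bigr => s _; ring.
Qed.

Let Q2_vert k p : W p -> dy k Q2 p = 2 * (u k p - beta p * b k p).
Proof.
move=> Wp.
rewrite (@pderive_eq_in _ _ _ e W oW _ _ (fun p => \sum_r y r p * u r p - beta p * beta p)) //.
rewrite (pderiveB (U := W)) //; [|by prove_smooth|by prove_smooth].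
rewrite (pderive_sum oW) //; last by move=> s; prove_smooth.
rewrite (pderiveM (U := W)) // beta_vert //.
rewrite (_ : \sum_r _ = 2 * u k p); first by ring.
transitivity (\sum_r (r == k)%:R * u r p + \sum_r a k r p * y r p).
  rewrite -big_split /=; apply: eq_bigr => r _.
  by rewrite (pderiveM (U := W)) // y_vert // u_vert // (a_sym r k Wp); ring.
by rewrite delta_sum -/(u k p); ring.
Qed.

Let qv k p : R := (u k p - beta p * b k p) / q p.

Let q_gt0 p : W p -> 0 < q p. Proof. by move=> /Q2_gt0; rewrite sqrtr_gt0. Qed.
Let q_neq0 p : W p -> q p != 0. Proof. by move=> /q_gt0 /gt_eqF ->. Qed.

Let q_vert k p : W p -> dy k q p = qv k p.
Proof.
move=> Wp.
rewrite /q (pderive_comp (inr k) (is_derive1_sqrt (Q2_gt0 Wp)) sQ2 Wp).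
rewrite Q2_vert // -/(q p) /qv; field; exact: q_neq0.
Qed.

Let uE k p : W p -> u k p = beta p * b k p + q p * qv k p.
Proof. by move=> Wp; rewrite /qv; field; exact: q_neq0. Qed.

Let yuE p : W p -> \sum_r y r p * u r p = beta p ^+ 2 + q p ^+ 2.
Proof. by move=> Wp; rewrite /q sqr_sqrtr ?ltW ?Q2_gt0 // Q2E; ring. Qed.

Let h_neq0 : h != 0. Proof. by rewrite gt_eqF. Qed.

Let BE p : B p = A p ^+ 2 + h ^+ 2 * q p ^+ 2.
Proof. by rewrite h2E /B /A; field. Qed.

Let B_gt0 p : W p -> 0 < B p.
Proof.
move=> Wp; rewrite BE ltr_wpDl ?sqr_ge0 //.
by rewrite mulr_gt0 // exprn_gt0 // q_gt0.
Qed.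
Let B_neq0 p : W p -> B p != 0. Proof. by move=> /B_gt0 /gt_eqF ->. Qed.

Let C p : R := Num.sqrt (B p).
Let C_gt0 p : W p -> 0 < C p. Proof. by move=> /B_gt0; rewrite sqrtr_gt0. Qed.
Let C_neq0 p : W p -> C p != 0. Proof. by move=> /C_gt0 /gt_eqF ->. Qed.
Let C2 p : W p -> C p ^+ 2 = B p.
Proof. by move=> Wp; rewrite sqr_sqrtr // ltW // B_gt0. Qed.

Let sA : smooth A. Proof. by rewrite /A; prove_smooth. Qed.
Let sB : smooth B. Proof. by rewrite /B; prove_smooth. Qed.
Let sC : smooth C. Proof. exact: smooth_sqrt. Qed.
Let sCV : smooth (fun p => (C p)^-1). Proof. exact: smoothV. Qed.

Let cosf p : R := A p / C p.
Let scosf : smooth cosf. Proof. by rewrite /cosf; prove_smooth. Qed.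

(** [B = A^2 + h^2 q^2]: if the cosine of the angle is [A / sqrt B], then its sine
   is [h q / sqrt B]. *)
Let sin2 p : W p -> 1 - cosf p ^+ 2 = (h * q p / C p) ^+ 2.
Proof.
move=> Wp; have Cn := C_neq0 Wp; rewrite /cosf.
transitivity ((C p ^+ 2 - A p ^+ 2) / C p ^+ 2); first by field.
by rewrite {1}C2 // BE; field.
Qed.

Let hqC_gt0 p : W p -> 0 < h * q p / C p.
Proof. by move=> Wp; rewrite divr_gt0 ?mulr_gt0 ?q_gt0 ?C_gt0. Qed.

Let cosf_bound p : W p -> -1 < cosf p < 1.
Proof.
move=> Wp; have := hqC_gt0 Wp; have := sin2 Wp; nra.
Qed.

Let f p : R := acos (cosf p).
Let sf : smooth f. Proof. exact: smooth_acos. Qed.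
Let sJ : smooth J.
Proof.
apply: smooth_expR => //; apply: smoothN => //; apply: smoothM => //.
  exact: smooth_cst.
by apply: smoothM => //; exact: smooth_cst.
Qed.
Let J_gt0 p : 0 < J p. Proof. exact: expR_gt0. Qed.
Let K_gt0 p : W p -> 0 < K p.
Proof. by move=> Wp; rewrite mulr_gt0 // C_gt0. Qed.
Let sK : smooth K. Proof. exact: smoothM. Qed.
Let skap : smooth kap.
Proof. by apply: smoothM => //; [exact: smooth_cst|exact: smooth_powR]. Qed.
Let kap_gt0 p : W p -> 0 < kap p.
Proof. by move=> Wp; rewrite mulr_gt0 ?invr_gt0 ?powR_gt0 ?K_gt0. Qed.
Let kap_neq0 p : W p -> kap p != 0. Proof. by move=> /kap_gt0 /gt_eqF ->. Qed.

Let lam p : R := J p / (kap p * h).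
Let lam_gt0 p : W p -> 0 < lam p.
Proof. by move=> Wp; rewrite /lam divr_gt0 ?J_gt0 // mulr_gt0 ?kap_gt0. Qed.
Let slam : smooth lam.
Proof.
apply: smoothM => //; apply: smoothV => //.
  by move=> p Wp; rewrite mulf_neq0 ?kap_neq0.
by apply: smoothM => //; exact: smooth_cst.
Qed.

Lemma smooth_zeta i : smooth (Z i).
Proof. by rewrite /Z; apply: smoothM => //; prove_smooth. Qed.

(** [rh] is the logarithmic derivative of [K], and [h] times [ph] is the derivative
    of the angle. *)
Let rh k p : R := (beta p * b k p + q p * qv k p + g * q p * b k p) / B p.
Let ph k p : R := (beta p * qv k p - q p * b k p) / B p.
Let Av k p : R := b k p + 2^-1 * g * qv k p.

Let A_vert k p : W p -> dy k A p = Av k p.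
Proof.
move=> Wp; rewrite /A (pderiveD (U := W)) //; last by prove_smooth.
by rewrite (pderiveZ (U := W)) // beta_vert // q_vert.
Qed.

Let B_vert k p : W p -> dy k B p = 2 * B p * (rh k p + 2^-1 * g * ph k p).
Proof.
move=> Wp.
rewrite (@pderive_eq_in _ _ _ e W oW _ _ (fun p => beta p * beta p + g * (beta p * q p) + q p * q p))
  //; last by move=> z _; rewrite /B; ring.
rewrite (pderiveD (U := W)) //; [|by prove_smooth|by prove_smooth].
rewrite (pderiveD (U := W)) //; [|by prove_smooth|by prove_smooth].
rewrite (pderiveZ (U := W)) //; last by prove_smooth.
rewrite !(pderiveM (U := W)) // beta_vert // q_vert // /rh /ph.
by field; exact: B_neq0.
Qed.

Let C_vert k p : W p -> dy k C p = C p * (rh k p + 2^-1 * g * ph k p).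
Proof.
move=> Wp; rewrite /C (pderive_comp (inr k) (is_derive1_sqrt (B_gt0 Wp)) sB Wp) B_vert //.
rewrite -/(C p) -C2 //; field; exact: C_neq0.
Qed.

Let cosf_vert k p : W p -> dy k cosf p = - (h * q p / C p) * (h * ph k p).
Proof.
move=> Wp; have Cn := C_neq0 Wp.
have E : A p * (rh k p + 2^-1 * g * ph k p) - Av k p = h ^+ 2 * q p * ph k p.
  by rewrite h2E /Av /A /rh /ph /B; field; exact: B_neq0.
have : dy k (fun z => cosf z * C z) p = dy k A p.
  by apply: (pderive_eq_in e oW) => // z Wz; rewrite /cosf mulfVK // C_neq0.
rewrite (pderiveM (U := W)) // C_vert // A_vert // => /eqP.
rewrite eq_sym -subr_eq => /eqP H; apply: (mulIf Cn); rewrite -H /cosf.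
rewrite (_ : - _ * _ * _ = - (h ^+ 2 * q p * ph k p)); last by field.
by rewrite -E; field.
Qed.

Let f_vert k p : W p -> dy k f p = h * ph k p.
Proof.
move=> Wp; rewrite /f (pderive_comp (inr k) (is_derive1_acos (cosf_bound Wp)) scosf Wp).
rewrite cosf_vert // sin2 // sqrtr_sqr gtr0_norm ?hqC_gt0 //.
rewrite !mulNr mulrN opprK mulrA mulVf ?mul1r //.
by rewrite gt_eqF // hqC_gt0.
Qed.

Let J_vert k p : W p -> dy k J p = - (2^-1 * g * ph k p) * J p.
Proof.
move=> Wp.
have -> : J = fun z => expR ((- (2^-1 * g / h)) * f z).
  by apply/funext => z; rewrite /J -/(cosf z) -/(f z); congr expR; ring.
rewrite (pderive_comp (inr k) (is_derive_expR _) _ Wp); last by prove_smooth.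
by rewrite (pderiveZ (U := W)) // f_vert //; field.
Qed.

Let K_vert k p : W p -> dy k K p = K p * rh k p.
Proof.
move=> Wp; rewrite /K (pderiveM (U := W)) // C_vert // J_vert // -/(C p).
by ring.
Qed.

Let K2_vert k p : W p ->
  dy k (fun z => K z ^+ 2) p = 2 * J p ^+ 2 * (u k p + g * q p * b k p).
Proof.
move=> Wp.
rewrite (@pderive_eq_in _ _ _ e W oW _ _ (fun z => K z * K z)) //.
rewrite (pderiveM (U := W)) // K_vert //.
rewrite (_ : _ + _ = 2 * K p ^+ 2 * rh k p); last by ring.
rewrite /K exprMn -/(C p) C2 // /rh uE //; field; exact: B_neq0.
Qed.

(** In polar coordinates the metric is [dK^2 + K^2 / h^2 (df^2 + sin^2 f |dn|^2)]
    with [n] on the unit sphere orthogonal to [bu]; this is that form divided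
    by [J^2]. *)
Let metric_form k l p : R := B p * rh k p * rh l p + B p * ph k p * ph l p
   + a k l p - b k p * b l p - qv k p * qv l p.

Let hessian_K2 k l p : W p ->
  2^-1 * dy k (dy l (fun z => K z ^+ 2)) p = J p ^+ 2 * metric_form k l p.
Proof.
move=> Wp.
rewrite (pderive_eq_in e oW _ (fun z => @K2_vert l z)) //.
rewrite (@pderive_eq_in _ _ _ e W oW _ _ (fun z => 2 * (J z * J z * (u l z + g * (q z * b l z)))))
  //; last by move=> z _; ring.
rewrite (pderiveZ (U := W)) //; last by prove_smooth.
rewrite (pderiveM (U := W)) //; [|by prove_smooth|by prove_smooth].
rewrite (pderiveD (U := W)) //; last by prove_smooth.
rewrite (pderiveZ (U := W)) //; last by prove_smooth.
rewrite !(pderiveM (U := W)) // J_vert // u_vert // b_vert // q_vert // uE //.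
rewrite (a_sym l k Wp) /metric_form /rh /ph /B.
by field; exact: B_neq0.
Qed.

Let kap_vert k p : W p -> dy k kap p = (1 - h) * kap p * rh k p.
Proof.
move=> Wp; rewrite /kap (pderiveZ (U := W)) //; last exact: smooth_powR.
rewrite (pderive_comp (inr k) (is_derive1_powR _ (K_gt0 Wp)) sK Wp) K_vert //.
have Kn : K p != 0 by rewrite gt_eqF // K_gt0.
have -> : K p `^ (1 - h) = K p * K p `^ (1 - h - 1).
  by rewrite -[X in X * _]powRr1 ?ltW ?K_gt0 // -powRD ?Kn ?implybT //; congr (_ `^ _); ring.
by ring.
Qed.

(** The logarithmic derivative of [lam]. *)
Let lv k p : R := - (2^-1 * g * ph k p) - (1 - h) * rh k p.

Let lam_vert k p : W p -> dy k lam p = lam p * lv k p.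
Proof.
move=> Wp; have kn : kap p * h != 0 by rewrite mulf_neq0 // kap_neq0.
have : dy k (fun z => h * (lam z * kap z)) p = dy k J p.
  apply: (pderive_eq_in e oW) => // z Wz; rewrite /lam; field.
  by rewrite h_neq0 kap_neq0.
rewrite (pderiveZ (U := W)) //; last by prove_smooth.
rewrite (pderiveM (U := W)) // kap_vert // J_vert //.
have -> : J p = h * (lam p * kap p).
  by rewrite /lam; field; rewrite h_neq0 kap_neq0.
move=> E; apply: (mulIf kn).
rewrite (_ : dy k lam p * _ = h * (dy k lam p * kap p + lam p * ((1 - h) * kap p * rh k p))
   - h * (lam p * ((1 - h) * kap p * rh k p))); last by ring.
by rewrite E /lv; ring.
Qed.


(** The field [Z] and its derivatives lie in the span of [y], [bu] and the
   coordinate vectors, so that all inner products needed come from one bilinear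
   formula. *)
Let combo_low (al ga ep : R) k r p : W p ->
  \sum_s a r s p * (al * y s p + ga * bu s p + ep * (s == k)%:R) =
  al * u r p + ga * b r p + ep * a r k p.
Proof.
move=> Wp; rewrite -[b r p]bu_low // -[a r k p](delta_sum (fun s => a r s p)).
rewrite /u !mulr_sumr -!big_split /=; apply: eq_bigr => s _; ring.
Qed.

Let combo_dot (al ga ep : R) k (F : 'I_N -> R) p :
  \sum_r (al * y r p + ga * bu r p + ep * (r == k)%:R) * F r =
  al * (\sum_r y r p * F r) + ga * (\sum_r bu r p * F r) + ep * F k.
Proof.
rewrite -[F k](delta_sum F) !mulr_sumr -!big_split /=.
by apply: eq_bigr => s _; ring.
Qed.

Let ybE p : \sum_r y r p * b r p = beta p.
Proof. by apply: eq_bigr => r _; rewrite mulrC. Qed.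

Let buuE p : W p -> \sum_r bu r p * u r p = beta p.
Proof.
move=> Wp; under eq_bigr do rewrite mulr_sumr.
rewrite exchange_big /=; apply: eq_bigr => s _.
rewrite -(bu_low s Wp) mulr_suml; apply: eq_bigr => r _.
by rewrite (a_sym s r Wp); ring.
Qed.

Let yaE k p : W p -> \sum_r y r p * a r k p = u k p.
Proof. by move=> Wp; apply: eq_bigr => r _; rewrite (a_sym r k Wp) mulrC. Qed.

Let buaE k p : W p -> \sum_r bu r p * a r k p = b k p.
Proof.
move=> Wp; rewrite -(bu_low k Wp).
by apply: eq_bigr => r _; rewrite (a_sym r k Wp) mulrC.
Qed.

Let combo_inner (al ga ep al' ga' ep' : R) k l p : W p ->
  \sum_r (al * y r p + ga * bu r p + ep * (r == k)%:R) *
    (\sum_s a r s p * (al' * y s p + ga' * bu s p + ep' * (s == l)%:R)) =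
  al * al' * (beta p ^+ 2 + q p ^+ 2) + (al * ga' + ga * al') * beta p + ga * ga'
  + ep * (al' * u k p + ga' * b k p) + ep' * (al * u l p + ga * b l p)
  + ep * ep' * a k l p.
Proof.
move=> Wp; rewrite combo_dot combo_low //.
have dist (F : 'I_N -> R) : \sum_r F r * (\sum_s a r s p *
      (al' * y s p + ga' * bu s p + ep' * (s == l)%:R)) =
    al' * (\sum_r F r * u r p) + ga' * (\sum_r F r * b r p)
    + ep' * (\sum_r F r * a r l p).
  rewrite !mulr_sumr -!big_split /=; apply: eq_bigr => r _.
  by rewrite combo_low //; ring.
by rewrite !dist yuE // ybE yaE // buuE // bu_unit // buaE //; ring.
Qed.

Let Z_combo k r p :
  Z r p = lam p * h * y r p + lam p * (A p - h * beta p) * bu r p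
          + 0 * (r == k)%:R.
Proof. by rewrite /Z -/(A p) -/(lam p); ring. Qed.

Let be k p := lv k p * lam p * (A p - h * beta p) + lam p * (Av k p - h * b k p).

Let Z_vert k r p : W p -> dy k (Z r) p =
  lv k p * lam p * h * y r p + be k p * bu r p + lam p * h * (r == k)%:R.
Proof.
move=> Wp.
rewrite (@pderive_eq_in _ _ _ e W oW _ _
  (fun z => lam z * (h * y r z + (A z - h * beta z) * bu r z))) //; last first.
  by move=> z _; rewrite (Z_combo k); ring.
rewrite (pderiveM (U := W)) //; last by prove_smooth.
rewrite lam_vert // (pderiveD (U := W)) //; [|by prove_smooth|by prove_smooth].
rewrite (pderiveZ (U := W)) // y_vert // (pderiveM (U := W)) //; last by prove_smooth.
rewrite bu_vert // (pderiveB (U := W)) //; last by prove_smooth.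
rewrite (pderiveZ (U := W)) // A_vert // beta_vert // /be.
by ring.
Qed.

Let Z_low r p := \sum_s a r s p * Z s p.

Let Z_low_combo k r p : Z_low r p = \sum_s a r s p *
  (lam p * h * y s p + lam p * (A p - h * beta p) * bu s p + 0 * (s == k)%:R).
Proof. by apply: eq_bigr => s _; congr (_ * _); exact: Z_combo. Qed.

Let ZZ p : W p -> \sum_r Z r p * Z_low r p = lam p ^+ 2 * B p.
Proof.
move=> Wp; have [k _] : exists k : 'I_N, True.
  apply: contrapT => none; have := Q2_gt0 Wp.
  by rewrite /Q2 big1 ?ltxx // => m; case: none; exists m.
rewrite (eq_bigr _ (fun r _ => congr2 *%R (Z_combo k r p) (Z_low_combo k r p))).
by rewrite combo_inner // BE /A; ring.
Qed.

(** Half the derivative of [|Z|^2 = K^(2h)]. *)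
Let PZ k p : W p ->
  \sum_r dy k (Z r) p * Z_low r p = lam p ^+ 2 * B p * (h * rh k p).
Proof.
move=> Wp.
rewrite (eq_bigr _ (fun r _ => congr2 *%R (Z_vert k r Wp) (Z_low_combo k r p))).
rewrite combo_inner // /be uE //.
have H : lv k p * B p + A p * Av k p + h ^+ 2 * (q p * qv k p) = B p * (h * rh k p).
  by rewrite /lv h2E /Av /rh /ph /A /B; field; exact: B_neq0.
rewrite -[RHS]mulrA -H BE /A; ring.
Qed.

Let pullbackE k l p : W p ->
  \sum_r \sum_s a r s p * (dy k (Z r) p * dy l (Z s) p) =
  lam p ^+ 2 * h ^+ 2 * metric_form k l p.
Proof.
move=> Wp.
transitivity (\sum_r dy k (Z r) p * \sum_s a r s p * dy l (Z s) p).
  by apply: eq_bigr => r _; rewrite mulr_sumr; apply: eq_bigr => s _; ring.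
transitivity (\sum_r
   (lv k p * lam p * h * y r p + be k p * bu r p + lam p * h * (r == k)%:R) *
   (\sum_s a r s p * (lv l p * lam p * h * y s p + be l p * bu s p
                      + lam p * h * (s == l)%:R))).
  apply: eq_bigr => r _; apply: congr2; first exact: Z_vert.
  by apply: eq_bigr => s _; apply: congr2 => //; exact: Z_vert.
rewrite combo_inner // /be !uE // /metric_form.
(* Half the derivative of [A^2 + h^2 q^2 = B]. *)
have H m : A p * Av m p + h ^+ 2 * (q p * qv m p) = B p * (h * rh m p) - lv m p * B p.
  by rewrite /lv h2E /Av /rh /ph /A /B; field; exact: B_neq0.
(* The Lagrange identity for [A dq - q dA], which is [B] times [ph]. *)
have H2 : Av k p * Av l p = (h * rh k p - lv k p) * (h * rh l p - lv l p) * B p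
   + h ^+ 2 * (B p * ph k p * ph l p - qv k p * qv l p).
  by rewrite /lv h2E /Av /rh /ph /B; field; exact: B_neq0.
transitivity (lam p ^+ 2 * (B p * lv k p * lv l p
   + lv k p * (A p * Av l p + h ^+ 2 * (q p * qv l p))
   + lv l p * (A p * Av k p + h ^+ 2 * (q p * qv k p))
   + h ^+ 2 * (a k l p - b k p * b l p) + Av k p * Av l p)).
  by rewrite BE; ring.
by rewrite !H H2; ring.
Qed.

(** The map [Z] has polar coordinates [K^h] and [f] with the same [n], which
    turns the polar form of the metric into [kap^2] times the Euclidean one. *)
Lemma metric_conformal k l p : W p ->
  2^-1 * dy k (dy l (fun z => K z ^+ 2)) p =
  kap p ^+ 2 * \sum_r \sum_s a r s p * (dy k (Z r) p * dy l (Z s) p).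
Proof.
move=> Wp; rewrite hessian_K2 // pullbackE // !mulrA; congr (_ * _).
by rewrite /lam; field; rewrite h_neq0 kap_neq0.
Qed.

(** As [|Z| = K^h], the factor [kap] is a constant times [|Z|^(1/h - 1)]. *)
Lemma conformal_factor_vert k p : W p ->
  dy k (fun z => kap z ^+ 2) p =
  2 * (h^-1 - 1) * kap p ^+ 2 / (\sum_r Z r p * (\sum_s a r s p * Z s p)) *
  \sum_r dy k (Z r) p * (\sum_s a r s p * Z s p).
Proof.
move=> Wp; rewrite (@pderive_eq_in _ _ _ e W oW _ _ (fun z => kap z * kap z)) //.
rewrite (pderiveM (U := W)) // kap_vert // ZZ // PZ //.
field; rewrite h_neq0 B_neq0 //= gt_eqF //; exact: lam_gt0.
Qed.

Lemma zeta_square_neq0 p : W p -> \sum_r Z r p * (\sum_s a r s p * Z s p) != 0.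
Proof. by move=> Wp; rewrite ZZ // mulf_neq0 ?B_neq0 // expf_neq0 // gt_eqF // lam_gt0. Qed.

Lemma conformal_factor_neq0 p : W p -> kap p ^+ 2 != 0.
Proof. by move=> Wp; rewrite expf_neq0 // kap_neq0. Qed.

Lemma smooth_conformal_factor : smooth (fun z => kap z ^+ 2).
Proof. exact: smoothX. Qed.

Lemma smooth_energy : smooth (fun z => K z ^+ 2).
Proof. exact: smoothX. Qed.

(** A direction [w] killed by the differential of [Z] preserves the length of [Z]
    and its component along [bu]; these two linear relations force the variations
    [bw] of [beta] and [qw] of [q] to vanish, and then [dZ (w) = lam h w]. *)
Lemma zeta_injective p (w : 'I_N -> R) : W p ->
  (forall r, \sum_k dy k (Z r) p * w k = 0) -> forall r, w r = 0.
Proof.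
move=> Wp Pw.
pose bw := \sum_k b k p * w k; pose qw := \sum_k qv k p * w k.
have comb (F : 'I_N -> R) (x1 x2 : R) : (forall k, F k = x1 * b k p + x2 * qv k p) ->
    \sum_k F k * w k = x1 * bw + x2 * qw.
  move=> FE; rewrite /bw /qw !mulr_sumr -big_split /=.
  by apply: eq_bigr => k _; rewrite FE; ring.
have dotP (F : 'I_N -> R) : \sum_k (\sum_r dy k (Z r) p * F r) * w k = 0.
  under eq_bigr do rewrite mulr_suml.
  rewrite exchange_big /= big1 // => r _.
  transitivity ((\sum_k dy k (Z r) p * w k) * F r); last by rewrite Pw mul0r.
  by rewrite mulr_suml; apply: eq_bigr => k _; ring.
have qn := q_neq0 Wp; have Bn := B_neq0 Wp; have lamn : lam p != 0.
  by rewrite gt_eqF // lam_gt0.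
(* The length of [Z] is preserved. *)
have R1 : (beta p + g * q p) * bw + q p * qw = 0.
  have := dotP (fun r => Z_low r p).
  rewrite (comb _ (lam p ^+ 2 * h * (beta p + g * q p)) (lam p ^+ 2 * h * q p)).
    move=> E; apply: (mulfI (mulf_neq0 (expf_neq0 2 lamn) h_neq0)).
    by rewrite mulr0 -E; ring.
  by move=> k; rewrite PZ // /rh; field.
pose x1 := 2^-1 * g * q p / B p - (1 - h) * (beta p + g * q p) / B p.
pose x2 := - (2^-1 * g * beta p / B p) - (1 - h) * q p / B p.
have lvE k : lv k p = x1 * b k p + x2 * qv k p.
  by rewrite /lv /x1 /x2 /ph /rh; ring.
have beE k : be k p = lam p * ((A p - h * beta p) * x1 + 1 - h) * b k p
    + lam p * ((A p - h * beta p) * x2 + 2^-1 * g) * qv k p.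
  by rewrite /be lvE /Av; ring.
(* The component of [Z] along [bu] is preserved. *)
have R2 : (A p * x1 + 1) * bw + (A p * x2 + 2^-1 * g) * qw = 0.
  have := dotP (fun r => b r p).
  rewrite (comb _ (lam p * (A p * x1 + 1)) (lam p * (A p * x2 + 2^-1 * g))).
    by move=> E; apply: (mulfI lamn); rewrite mulr0 -E; ring.
  move=> k; under eq_bigr => r _ do rewrite Z_vert //.
  by rewrite combo_dot ybE bu_unit // beE lvE; ring.
(* The first coefficient below discards the terms of [x1] and [x2] proportional to
   the variation of [K]; the second eliminates [qw], using
   [B - A beta = q (q + g beta / 2)]. What is left is [B h^2] times [bw]. *)
have bw0 : bw = 0.
  apply: (mulfI (mulf_neq0 Bn (expf_neq0 2 h_neq0))); rewrite mulr0.
  transitivity (B p * ((A p * x1 + 1) * bw + (A p * x2 + 2^-1 * g) * qw)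
    + (A p * (1 - h) - 2^-1 * g * (2^-1 * g * beta p + q p)) *
      ((beta p + g * q p) * bw + q p * qw)).
    by rewrite h2E /x1 /x2 /A /B; field; exact: Bn.
  by rewrite R1 R2; ring.
have qw0 : qw = 0.
  by apply: (mulfI qn); rewrite mulr0 -R1 bw0; ring.
move=> r; apply: (mulfI (mulf_neq0 lamn h_neq0)); rewrite mulr0 -(Pw r).
transitivity ((\sum_k lv k p * w k) * (lam p * h * y r p) +
  (\sum_k be k p * w k) * bu r p + lam p * h * \sum_k (k == r)%:R * w k).
  rewrite (comb _ _ _ lvE) (comb _ _ _ beE) bw0 qw0 delta_sum; ring.
rewrite !mulr_suml mulr_sumr -!big_split /=; apply: eq_bigr => k _.
by rewrite Z_vert // (eq_sym r k); ring.
Qed.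

End FinsleroidFibre.

(** * The Riemannian curvature tensor *)

Section LeviCivita.
Context {R : realType} {V : normedModType R} {N : nat}.
Context (e : 'I_N + 'I_N -> V) (W : set V).
Implicit Types (p : V) (i j k l m n u : 'I_N).
Local Notation smooth := (smooth e W).
Local Notation dx i := (pderive e (inl i)).
Context (a ai : 'I_N -> 'I_N -> V -> R).

Definition levi_civita l k j p : R := 2^-1 * \sum_u ai l u p *
  (dx k (a u j) p + dx j (a u k) p - dx u (a k j) p).

Local Notation Gam := levi_civita.

Definition riemann_tensor k l i j p : R :=
  dx i (Gam l k j) p - dx j (Gam l k i) p
  + \sum_u Gam u k j p * Gam l u i p - \sum_u Gam u k i p * Gam l u j p.

Hypotheses (oW : open W) (sa : forall i j, smooth (a i j)).
Hypothesis sai : forall i j, smooth (ai i j).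
Hypothesis a_sym : forall i j p, W p -> a i j p = a j i p.
Hypothesis aiK : forall n u p, W p -> \sum_m a n m p * ai m u p = (u == n)%:R.

Lemma smooth_levi_civita l k j : smooth (Gam l k j).
Proof.
rewrite /levi_civita; apply: smoothM => //; first exact: smooth_cst.
by apply: smooth_sum => // u; prove_smooth.
Qed.

Lemma smooth_riemann_tensor k l i j : smooth (riemann_tensor k l i j).
Proof.
have sG := smooth_levi_civita; rewrite /riemann_tensor.
by prove_smooth.
Qed.

(** The Christoffel symbol of the first kind. *)
Definition gamma_low n k j p : R :=
  2^-1 * (dx k (a n j) p + dx j (a n k) p - dx n (a k j) p).

Lemma gamma_lowE n k j p : W p -> \sum_m a n m p * Gam m k j p = gamma_low n k j p.
Proof.
move=> Wp; rewrite /Gam.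
under eq_bigr do rewrite mulrCA mulr_sumr.
rewrite -mulr_sumr; congr (_ * _); rewrite exchange_big /=.
rewrite -[RHS](delta_sum (fun u => dx k (a u j) p + dx j (a u k) p - dx u (a k j) p)).
apply: eq_bigr => u _; rewrite -(aiK n u Wp) mulr_suml.
by apply: eq_bigr => m _; rewrite mulrA.
Qed.

Lemma smooth_gamma_low n k j : smooth (gamma_low n k j).
Proof. by rewrite /gamma_low; prove_smooth. Qed.

Lemma dx_sym i k n p : W p -> dx i (a k n) p = dx i (a n k) p.
Proof. by move=> Wp; apply: (pderive_eq_in e oW) => // z; exact: a_sym. Qed.

(** The Levi-Civita connection preserves the metric. *)
Lemma gamma_low_metric n k i p : W p ->
  gamma_low n k i p + gamma_low k n i p = dx i (a n k) p.
Proof.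
move=> Wp; by rewrite /gamma_low (dx_sym i k n Wp); field.
Qed.

Let quad n i k j p := \sum_m gamma_low m n i p * Gam m k j p.

Let quadC n i k j p : W p -> quad n i k j p = quad k j n i p.
Proof.
move=> Wp; rewrite /quad.
under eq_bigr => m _ do rewrite -gamma_lowE // mulr_suml.
under [RHS]eq_bigr => m _ do rewrite -gamma_lowE // mulr_suml.
rewrite exchange_big /=; apply: eq_bigr => m _; apply: eq_bigr => l _.
by rewrite (a_sym l m Wp); ring.
Qed.

Let lowered k n i j p : W p -> \sum_m a n m p * riemann_tensor k m i j p =
  dx i (gamma_low n k j) p - dx j (gamma_low n k i) p
  - quad n i k j p + quad n j k i p.
Proof.
move=> Wp; have sG := smooth_levi_civita.
have D c d : \sum_m a n m p * dx c (Gam m k d) p =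
    dx c (gamma_low n k d) p - \sum_m gamma_low n m c p * Gam m k d p - quad n c k d p.
  rewrite -(pderive_eq_in e oW _ (fun z => @gamma_lowE n k d z)) //.
  rewrite (pderive_sum oW) //; last by move=> m; prove_smooth.
  rewrite /quad -!sumrB; apply: eq_bigr => m _.
  by rewrite (pderiveM (U := W)) // -gamma_low_metric //; ring.
have Q c d : \sum_m a n m p * (\sum_u Gam u k c p * Gam m u d p) =
    \sum_m gamma_low n m d p * Gam m k c p.
  under eq_bigr do rewrite mulr_sumr.
  rewrite exchange_big /=; apply: eq_bigr => u _.
  rewrite -gamma_lowE // mulr_suml; apply: eq_bigr => m _; ring.
transitivity (\sum_m a n m p * dx i (Gam m k j) p - \sum_m a n m p * dx j (Gam m k i) p
   + \sum_m a n m p * (\sum_u Gam u k j p * Gam m u i p)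
   - \sum_m a n m p * (\sum_u Gam u k i p * Gam m u j p)).
  rewrite -sumrB -big_split -sumrB /=; apply: eq_bigr => m _.
  by rewrite /riemann_tensor; ring.
rewrite !D !Q; ring.
Qed.

(** After lowering the index the second derivatives of the metric cancel by the
    symmetry of second derivatives, and the terms quadratic in the connection by
    [quadC]. *)
Lemma riemann_skew k n i j p : W p ->
  \sum_m a n m p * riemann_tensor k m i j p =
  - \sum_m a k m p * riemann_tensor n m i j p.
Proof.
move=> Wp; apply/eqP; rewrite -addr_eq0 !lowered //.
have S c d : dx c (gamma_low n k d) p + dx c (gamma_low k n d) p =
    dx c (dx d (a n k)) p.
  rewrite -(pderiveD (U := W)) //; try exact: smooth_gamma_low.
  by apply: (pderive_eq_in e oW) => // z Wz; rewrite gamma_low_metric.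
have S1 := S i j; have S2 := S j i.
rewrite (pderiveC oW _ _ (sa n k) Wp) in S1.
rewrite (quadC k i n j Wp) (quadC k j n i Wp).
apply/eqP; transitivity
  ((dx i (gamma_low n k j) p + dx i (gamma_low k n j) p) -
   (dx j (gamma_low n k i) p + dx j (gamma_low k n i) p)); first by ring.
by rewrite S1 S2 subrr.
Qed.

End LeviCivita.

(** * Functions on the tangent space in local coordinates *)

Section TangentSpace.
Context {R : realType} {N : nat}.
Local Notation X := 'rV[R]_N.
Local Notation TX := (X * X)%type.
Implicit Types (F : X -> X -> R) (x y : X) (p : TX) (i k : 'I_N).

(** The coordinate vectors of the tangent space: [inl] along the base, [inr] along
    the fibre. *)
Definition frame (s : 'I_N + 'I_N) : TX :=
  match s with inl i => ('e_i, 0) | inr i => (0, 'e_i) end.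

Local Notation dx i := (pderive frame (inl i)).
Local Notation dy i := (pderive frame (inr i)).

Lemma pderive_x i F p : dx i (fun q => F q.1 q.2) p = partial_x i F p.1 p.2.
Proof.
rewrite pderiveE /partial_x /partial derive_line [RHS]derive_line.
apply: (congr1 (fun f : R -> R => 'D_1 f 0)); apply/funext => t /=.
by rewrite scaler0 add0r.
Qed.

Lemma pderive_y i F p : dy i (fun q => F q.1 q.2) p = partial_y i F p.1 p.2.
Proof.
rewrite pderiveE /partial_y /partial derive_line [RHS]derive_line.
apply: (congr1 (fun f : R -> R => 'D_1 f 0)); apply/funext => t /=.
by rewrite scaler0 add0r.
Qed.

Lemma pderive_base_x i (F : X -> R) : dx i (fun q => F q.1) = (fun q => partial i F q.1).
Proof.
by apply/funext => p; rewrite (pderive_x i (fun z _ => F z)).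
Qed.

Lemma pderive_base_y i (F : X -> R) : dy i (fun q => F q.1) = (fun=> 0).
Proof.
apply/funext => p; rewrite (pderive_y i (fun z _ => F z)).
exact: derive_cst.
Qed.

Context (U : set X).
Hypothesis oU : open U.

Let cylinder := [set p : TX | U p.1].

Lemma open_cylinder : open cylinder.
Proof.
by apply: open_comp => // p _; exact: cvg_fst.
Qed.

Lemma smooth_base (F : X -> R) : smooth_on U F -> smooth frame cylinder (fun p => F p.1).
Proof.
move=> sF k; elim: k F {sF}(sF k) => [|k IH] F [cF H].
  split=> // p Up; apply: continuous_comp; first exact: cvg_fst.
  by apply: cF; rewrite inE.
split=> [p Up|].
  apply: continuous_comp; first exact: cvg_fst.
  by apply: cF; rewrite inE.
case=> i; last first.
  rewrite -pderiveE pderive_base_y; split; last exact: (diffn_cst _ open_cylinder).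
  move=> p Up; apply/derivable1P.
  rewrite (_ : (fun _ : R => _) = (fun=> F p.1)); first exact: derivable_cst.
  by apply/funext => t /=; rewrite scaler0 add0r.
have [dF sF] := H i; rewrite -pderiveE pderive_base_x; split; last exact: IH.
move=> p Up; apply/derivable1P.
rewrite (_ : (fun _ : R => _) = (fun t => F (t *: 'e_i + p.1))).
  by apply/(derivable1P F p.1 'e_i); exact: dF.
by apply/funext => t.
Qed.

Lemma is_derive_coord (s : 'I_N + 'I_N) k p :
  is_derive p (frame s) (fun q : TX => q.2 0 k) ((frame s).2 0 k).
Proof.
apply/is_derive_line.
have -> : (fun t : R => (t *: frame s + p).2 0 k) =
    (fun t => (frame s).2 0 k * t + p.2 0 k).
  by apply/funext => t; rewrite /= !mxE mulrC.
have H : is_derive (0 : R) 1 (fun t : R => (frame s).2 0 k *: t + p.2 0 k)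
    ((frame s).2 0 k *: 1 + 0).
  apply: is_deriveD; exact: is_derive_cst.
by rewrite addr0 in H; apply: (is_derive_eq H); exact: mulr1.
Qed.

Lemma pderive_coord (s : 'I_N + 'I_N) k p :
  pderive frame s (fun q => q.2 0 k) p = (frame s).2 0 k.
Proof. by apply: pderive_val; exact: is_derive_coord. Qed.

Lemma smooth_coord k : smooth frame cylinder (fun p => p.2 0 k).
Proof.
apply: diffn_bootstrap => [p _|s p _|n s _].
- apply: (@continuous_comp _ _ _ snd (fun z : X => z 0 k)); first exact: cvg_snd.
  exact: coord_continuous.
- by have [] := is_derive_coord s k p.
rewrite -pderiveE (_ : pderive _ _ _ = fun=> (frame s).2 0 k).
  exact: (diffn_cst _ open_cylinder).
by apply/funext => p; exact: pderive_coord.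
Qed.

End TangentSpace.

(** * The angle-preserving connection *)

Section Assembly.
Context {R : realType} {N : nat}.
Local Notation X := 'rV[R]_N.
Local Notation TX := (X * X)%type.
Implicit Types (x y : X) (p : TX) (i j k l m n r s : 'I_N).
Context (U : set X) (a : X -> 'M[R]_N) (b : X -> X) (g : R).
Local Notation frame := (@frame R N).
Local Notation dx i := (pderive frame (inl i)).
Local Notation dy i := (pderive frame (inr i)).

Hypotheses (oU : open U) (g_bounds : -2 < g < 2).
Hypothesis a_smooth : forall i j, smooth_on U (fun x => a x i j).
Hypothesis b_smooth : forall i, smooth_on U (fun x => b x 0 i).
Hypothesis a_symm : forall x, U x -> forall i j, a x i j = a x j i.
Hypothesis a_pos : forall x, U x -> forall y : X, y != 0 ->
  0 < \sum_i \sum_j a x i j * y 0 i * y 0 j.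
Hypothesis b_unit : forall x, U x -> unit_length a b x.

Let af i j p : R := a p.1 i j.
Let bf i p : R := b p.1 0 i.
Let buf i p : R := bup a b p.1 i.
Let yf i p : R := p.2 0 i.
Let Q2 p : R := \sum_m \sum_n (af m n p - bf m p * bf n p) * yf m p * yf n p.
(** Points [(x, y)] of the tangent space with [q (x, y) <> 0]. *)
Let W : set TX := [set p | U p.1 /\ 0 < Q2 p].
Local Notation smoothW := (smooth frame W).
Local Notation h := (hpar g).

Let cyl := [set p : TX | U p.1].

Let h_gt0 : 0 < h.
Proof. rewrite sqrtr_gt0; move: g_bounds; nra. Qed.

Let h2E : h ^+ 2 = 1 - g ^+ 2 / 4.
Proof. by rewrite sqr_sqrtr //; move: g_bounds; nra. Qed.

Let sQ2 : smooth frame cyl Q2.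
Proof.
have oC := open_cylinder oU.
have s1 i j : smooth frame cyl (af i j) by exact: (smooth_base oU (a_smooth i j)).
have s2 i : smooth frame cyl (bf i) by exact: (smooth_base oU (b_smooth i)).
have s3 i : smooth frame cyl (yf i) by exact: (smooth_coord oU i).
rewrite /Q2; apply: smooth_sum => // m; apply: smooth_sum => // n.
by prove_smooth.
Qed.

Let oW : open W.
Proof.
rewrite openE => p [Up Qp] /=; apply: filterI.
  exact: open_nbhs_nbhs (conj (open_cylinder oU) Up).
have c := smooth_continuous sQ2 Up.
have P : nbhs (Q2 p) [set t : R | 0 < t].
  exact: open_nbhs_nbhs (conj (@open_gt _ 0) Qp).
exact: c P.
Qed.

Let Wcyl : W `<=` cyl. Proof. by move=> p []. Qed.

Let sa i j : smoothW (af i j).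
Proof. by exact: smooth_subset Wcyl (smooth_base oU (a_smooth i j)). Qed.
Let sb i : smoothW (bf i).
Proof. by exact: smooth_subset Wcyl (smooth_base oU (b_smooth i)). Qed.
Let sy i : smoothW (yf i).
Proof. by exact: smooth_subset Wcyl (smooth_coord oU i). Qed.

Let a_unit x : U x -> a x \in unitmx.
Proof.
move=> Ux; rewrite -row_free_unit; apply: inj_row_free => v va0.
apply/eqP; apply: contraT => vn0; have := a_pos Ux vn0.
rewrite (_ : \sum_i _ = 0) ?ltxx // exchange_big /= big1 // => j _.
have /matrixP /(_ 0 j) := va0; rewrite !mxE => E.
rewrite -mulr_suml (_ : \sum_i _ = 0) ?mul0r // -[RHS]E.
by apply: eq_bigr => i _; rewrite mulrC.
Qed.

Let a_tr x : U x -> (a x)^T = a x.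
Proof. by move=> Ux; apply/matrixP => i j; rewrite mxE a_symm. Qed.

Let aif i j p : R := ainv a p.1 i j.
Let sai i j : smoothW (aif i j).
Proof.
apply: (smooth_invmx (A := fun p => a p.1) oW) => [k l|p [Up _]].
  exact: sa.
exact: a_unit.
Qed.

Let sbu i : smoothW (buf i).
Proof.
rewrite /buf /bup; apply: smooth_sum => // j.
have H := smoothM oW (sai i j) (sb j); exact: H.
Qed.

Let a_sym r s p : W p -> af r s p = af s r p.
Proof. by case=> Up _; exact: a_symm. Qed.
Let aiK n u p : W p -> \sum_m af n m p * aif m u p = (u == n)%:R.
Proof.
case=> Up _; have /matrixP /(_ n u) := mulmxV (a_unit Up).
by rewrite !mxE eq_sym.
Qed.
Let bu_low r p : W p -> \sum_s af r s p * buf s p = bf r p.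
Proof.
move=> Wp; rewrite /buf /bup; under eq_bigr do rewrite mulr_sumr.
rewrite exchange_big /= -[RHS](delta_sum (fun s => bf s p)).
apply: eq_bigr => s _; rewrite -(aiK r s Wp) mulr_suml.
by apply: eq_bigr => m _; rewrite mulrA.
Qed.
Let bu_unit p : W p -> \sum_r buf r p * bf r p = 1.
Proof.
move=> Wp; rewrite -[RHS](b_unit (proj1 Wp)); apply: eq_bigr => r _.
rewrite -bu_low // mulr_sumr; apply: eq_bigr => s _.
by rewrite /af /buf; ring.
Qed.

Let a_vert k r s p : dy k (af r s) p = 0.
Proof. by rewrite /af (pderive_base_y k (fun x => a x r s)). Qed.
Let b_vert k r p : dy k (bf r) p = 0.
Proof. by rewrite /bf (pderive_base_y k (fun x => b x 0 r)). Qed.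
Let bu_vert k r p : dy k (buf r) p = 0.
Proof. by rewrite /buf (pderive_base_y k (fun x => bup a b x r)). Qed.
Let y_vert k r p : dy k (yf r) p = (r == k)%:R.
Proof. by rewrite /yf pderive_coord !mxE eqxx. Qed.

Let Zf i p := zeta a b g i p.1 p.2.
Let Kf p := Kval a b g p.1 p.2.
Let kapf p := varkappa a b g p.1 p.2.

Let sZ i : smoothW (Zf i).
Proof.
exact: (smooth_zeta oW (fun p Wp => proj2 Wp) h_gt0 h2E sa sb sbu sy).
Qed.

Let Q2_gt0 p : W p -> 0 < Q2 p. Proof. by case. Qed.

Let sK2 : smoothW (fun p => Kf p ^+ 2).
Proof. exact: (smooth_energy oW Q2_gt0 h_gt0 h2E sa sb sy). Qed.

Let skap2 : smoothW (fun p => kapf p ^+ 2).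
Proof. exact: (smooth_conformal_factor oW Q2_gt0 h_gt0 h2E sa sb sy). Qed.

Let gf n l p := 2^-1 * dy n (dy l (fun q => Kf q ^+ 2)) p.

Let gmetE p : gmet a b g p.1 p.2 = \matrix_(n, l) gf n l p.
Proof.
apply/matrixP => n l; rewrite !mxE /gf; congr (_ * _).
rewrite -pderive_y; congr (pderive _ _ _ p).
by apply/funext => q; rewrite -pderive_y.
Qed.

Let gf_conformal n l p : W p -> gf n l p = kapf p ^+ 2 *
  \sum_r \sum_s af r s p * (dy n (Zf r) p * dy l (Zf s) p).
Proof.
move=> Wp.
exact: (metric_conformal oW Q2_gt0 h_gt0 h2E sa sb sbu sy a_sym
  (fun k r s q _ => a_vert k r s q) (fun k r q _ => b_vert k r q)
  (fun k r q _ => bu_vert k r q) (fun k r q _ => y_vert k r q) bu_low bu_unit n l Wp).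
Qed.

Let kap2_vert k p : W p -> dy k (fun q => kapf q ^+ 2) p =
  2 * (h^-1 - 1) * kapf p ^+ 2 / (\sum_r Zf r p * zlow af Zf r p) *
  \sum_r dy k (Zf r) p * zlow af Zf r p.
Proof.
move=> Wp.
exact: (conformal_factor_vert oW Q2_gt0 h_gt0 h2E sa sb sbu sy a_sym
  (fun k r s q _ => a_vert k r s q) (fun k r q _ => b_vert k r q)
  (fun k r q _ => bu_vert k r q) (fun k r q _ => y_vert k r q) bu_low bu_unit k Wp).
Qed.

Let S2_neq0 p : W p -> \sum_r Zf r p * zlow af Zf r p != 0.
Proof.
move=> Wp; exact: (zeta_square_neq0 Q2_gt0 h_gt0 h2E a_sym bu_low bu_unit Wp).
Qed.

Let kap2_neq0 p : W p -> kapf p ^+ 2 != 0.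
Proof. by move=> Wp; exact: (conformal_factor_neq0 Q2_gt0 h_gt0 h2E Wp). Qed.

Let Pmx p : 'M[R]_N := \matrix_(r, k) dy k (Zf r) p.

Let Pmx_unit p : W p -> Pmx p \in unitmx.
Proof.
move=> Wp; rewrite -unitmx_tr -row_free_unit; apply: inj_row_free => v vP.
apply/rowP => r; rewrite [RHS]mxE.
apply: (zeta_injective oW Q2_gt0 h_gt0 h2E sa sb sbu sy a_sym
  (fun k r s q _ => a_vert k r s q) (fun k r q _ => b_vert k r q)
  (fun k r q _ => bu_vert k r q) (fun k r q _ => y_vert k r q) bu_low bu_unit
  (w := fun k => v 0 k) Wp) => s.
have /rowP /(_ s) := vP; rewrite !mxE => E; rewrite -[RHS]E.
by apply: eq_bigr => k _; rewrite !mxE mulrC.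
Qed.

Let zeta_invE p : zeta_inv a b g p.1 p.2 = invmx (Pmx p).
Proof.
rewrite /zeta_inv; congr invmx; apply/matrixP => r k.
by rewrite !mxE -pderive_y.
Qed.

Local Notation Gam := (levi_civita frame af aif).

Let christoffelE l k j p : christoffel a p.1 l k j = Gam l k j p.
Proof.
rewrite /christoffel /levi_civita; congr (_ * _); apply: eq_bigr => u _.
rewrite /af (pderive_base_x k (fun x => a x u j)) (pderive_base_x j (fun x => a x u k)).
by rewrite (pderive_base_x u (fun x => a x k j)).
Qed.

Let sGam l k j : smoothW (Gam l k j). Proof. exact: smooth_levi_civita. Qed.

Let Gam_base l k j : Gam l k j = fun p => christoffel a p.1 l k j.
Proof. by apply/funext => p; rewrite christoffelE. Qed.

Let Gam_vert m l k j p : dy m (Gam l k j) p = 0.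
Proof. by rewrite Gam_base (pderive_base_y m (fun x => christoffel a x l k j)). Qed.

Local Notation Rm := (riemann_tensor frame af aif).

Let riemannE k l i j p : riemann a p.1 k l i j = Rm k l i j p.
Proof.
rewrite /riemann /riemann_tensor.
rewrite !Gam_base (pderive_base_x i (fun x => christoffel a x l k j)).
rewrite (pderive_base_x j (fun x => christoffel a x l k i)).
by congr (_ + _ - _); apply: eq_bigr => u _; rewrite !Gam_base.
Qed.

Let Rm_vert m k l i j p : dy m (Rm k l i j) p = 0.
Proof.
rewrite (_ : Rm k l i j = fun q => riemann a q.1 k l i j).
  by rewrite (pderive_base_y m (fun x => riemann a x k l i j)).
by apply/funext => q; rewrite riemannE.
Qed.

Let Nf m n p := - \sum_i invmx (Pmx p) m i *
  (dx n (Zf i) p + \sum_k Gam i k n p * Zf k p).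

Let NconnE m n p : Nconn a b g m n p.1 p.2 = Nf m n p.
Proof.
rewrite /Nconn /Nf zeta_invE; congr (- _); apply: eq_bigr => i _; congr (_ * _).
rewrite -pderive_x; congr (_ + _); apply: eq_bigr => k _.
by rewrite christoffelE.
Qed.

Let sN m n : smoothW (Nf m n).
Proof.
have sPi i : smoothW (fun p => invmx (Pmx p) m i).
  apply: (smooth_invmx (A := Pmx) oW) => [r k|]; last exact: Pmx_unit.
  apply: (@smooth_eq_in _ _ _ _ _ oW (dy k (Zf r))) => [q _|]; first by rewrite mxE.
  exact: smooth_pderive.
by rewrite /Nf; prove_smooth.
Qed.

Local Notation hor := (horizontal frame Nf).

(** In the coordinates [(x, Z)] the connection is the Levi-Civita connection. *)
Let horizontal_zeta l n p : W p -> hor n (Zf l) p = - \sum_k Gam l k n p * Zf k p.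
Proof.
move=> Wp; rewrite /horizontal.
pose c : 'cV[R]_N := \col_i (dx n (Zf i) p + \sum_k Gam i k n p * Zf k p).
have -> : \sum_k Nf k n p * dy k (Zf l) p = - (Pmx p *m (invmx (Pmx p) *m c)) l 0.
  rewrite mxE -sumrN; apply: eq_bigr => k _; rewrite /Nf !mxE mulNr mulrC.
  by congr (- (_ * _)); apply: eq_bigr => i _; rewrite mxE.
by rewrite mulKVmx ?Pmx_unit // mxE opprD addNKr.
Qed.

Let hor_Gam i l k j p : hor i (Gam l k j) p = dx i (Gam l k j) p.
Proof.
by rewrite /horizontal big1 ?addr0 // => m _; rewrite Gam_vert mulr0.
Qed.

Local Notation br := (bracket frame Nf).

Let bracket_zeta l i j p : W p ->
  \sum_n dy n (Zf l) p * br n i j p = - \sum_k Zf k p * Rm k l i j p.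
Proof.
move=> Wp; rewrite (bracket_linear oW sN sZ sGam horizontal_zeta) //.
congr (- _); apply: eq_bigr => k _; congr (_ * _).
by rewrite /curvature !hor_Gam.
Qed.

Let dhorE i F p : dhor a b g i F p.1 p.2 = hor i (fun q => F q.1 q.2) p.
Proof.
rewrite /dhor /horizontal pderive_x; congr (_ + _); apply: eq_bigr => k _.
by rewrite NconnE pderive_y.
Qed.

Let NconnE' m n : (fun q : TX => Nconn a b g m n q.1 q.2) = Nf m n.
Proof. by apply/funext => q; rewrite NconnE. Qed.

Let MtensE n i j p : Mtens a b g n i j p.1 p.2 = br n i j p.
Proof. by rewrite /Mtens !dhorE !NconnE'. Qed.

Let DconnE n j k : (fun q : TX => Dconn a b g n j k q.1 q.2) =
  fun q => - dy k (Nf n j) q.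
Proof. by apply/funext => q; rewrite /Dconn -pderive_y NconnE'. Qed.

Let EtensE k n i j p : W p -> Etens a b g k n i j p.1 p.2 = - dy k (br n i j) p.
Proof.
move=> Wp; apply: (etrans _ (vertical_bracket oW sN k n i j Wp)).
have H c m d : dhor a b g c (Dconn a b g m d k) p.1 p.2 =
    hor c (fun q => - dy k (Nf m d) q) p.
  by rewrite dhorE; exact: (congr1 (fun F => hor c F p) (DconnE m d k)).
have D m c d : Dconn a b g m c d p.1 p.2 = - dy d (Nf m c) p.
  exact: (congr1 (fun f => f p) (DconnE m c d)).
rewrite /Etens (H i n j) (H j n i).
by congr (_ + _ - _); apply: eq_bigr => m _; rewrite !D.
Qed.

Let cartanE m l k p : cartan a b g m l k p.1 p.2 = 2^-1 * dy k (gf m l) p.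
Proof.
rewrite /cartan; congr (_ * _); rewrite -pderive_y.
by congr (pderive _ _ _ p); apply/funext => q; rewrite gmetE mxE.
Qed.

Let A p : 'M[R]_N := a p.1.

Let gmet_pullback p : W p ->
  gmet a b g p.1 p.2 = kapf p ^+ 2 *: ((Pmx p)^T *m A p *m Pmx p).
Proof.
move=> Wp; rewrite gmetE; apply/matrixP => n l; rewrite !mxE gf_conformal //.
congr (_ * _); rewrite exchange_big /=; apply: eq_bigr => s _.
rewrite !mxE mulr_suml; apply: eq_bigr => r _; rewrite !mxE /af /A; ring.
Qed.

Let gmet_unit p : W p -> gmet a b g p.1 p.2 \in unitmx.
Proof.
move=> Wp; rewrite gmet_pullback // unitmxZ ?unitfE ?kap2_neq0 //.
by rewrite !unitmx_mul unitmx_tr Pmx_unit //= a_unit //; case: Wp.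
Qed.

Let Rlow_skew i j m r p : W p ->
  Rlow af (fun k l => Rm k l i j) m r p = - Rlow af (fun k l => Rm k l i j) r m p.
Proof. by move=> Wp; exact: (riemann_skew oW sa sai a_sym aiK). Qed.

Let vf i j n p := - br n i j p.

Let sv i j n : smoothW (vf i j n).
Proof. by apply: smoothN => //; exact: smooth_bracket. Qed.

(** The covariant derivative of [vf i j] for the Finsler metric of the fibre. *)
Let rho_lowE k n i j p : W p -> rho_low a b g k n i j p.1 p.2 =
  \sum_m gf n m p * dy k (vf i j m) p +
  \sum_l vf i j l p * (2^-1 * dy k (gf n l) p).
Proof.
move=> Wp; rewrite /rho_low /rho.
have sbr m : smoothW (br m i j) by exact: smooth_bracket.
transitivity (\sum_m gf n m p * dy k (vf i j m) p - \sum_m gf n m p *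
    \sum_l br l i j p * cartan_up a b g m l k p.1 p.2).
  rewrite -sumrB; apply: eq_bigr => m _.
  rewrite gmetE mxE EtensE // /vf (pderiveN (U := W)) // mulrBr; congr (_ - _ * _).
  by apply: eq_bigr => l _; rewrite MtensE.
congr (_ + _).
under eq_bigr do rewrite mulr_sumr.
rewrite exchange_big -sumrN /=; apply: eq_bigr => l _.
rewrite /vf mulNr -cartanE; congr (- _).
transitivity (br l i j p * (gmet a b g p.1 p.2 *m (ginv a b g p.1 p.2 *m
    \col_m cartan a b g m l k p.1 p.2)) n 0).
  rewrite !mxE mulr_sumr; apply: eq_bigr => m _; rewrite gmetE !mxE.
  rewrite mulrCA; congr (_ * (_ * _)); rewrite /cartan_up /ginv gmetE.
  by apply: eq_bigr => r _; rewrite !mxE.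
by rewrite mulKVmx ?gmet_unit // mxE.
Qed.

Let v_linear i j l p : W p ->
  \sum_n dy n (Zf l) p * vf i j n p = \sum_m Zf m p * Rm m l i j p.
Proof.
move=> Wp; rewrite -[RHS]opprK -bracket_zeta // -sumrN.
by apply: eq_bigr => n _; rewrite mulrN.
Qed.

Let gf_hessian k n l p : W p -> dy k (gf n l) p = dy l (gf n k) p.
Proof.
move=> Wp; have sd (t : 'I_N + 'I_N) : smoothW (pderive frame t (fun q => Kf q ^+ 2)).
  exact: smooth_pderive.
have sdd (t t' : 'I_N + 'I_N) :
    smoothW (pderive frame t (pderive frame t' (fun q => Kf q ^+ 2))).
  exact: smooth_pderive.
rewrite /gf !(pderiveZ (U := W)) //; congr (_ * _).
rewrite (pderiveC oW _ _ (sd (inr l)) Wp) (pderiveC oW _ _ (sd (inr k)) Wp).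
by apply: (pderive_eq_in frame oW) => // q Wq; exact: (pderiveC oW _ _ sK2 Wq).
Qed.

Let gf_sym n l p : W p -> gf n l p = gf l n p.
Proof. by move=> Wp; rewrite /gf (pderiveC oW _ _ sK2 Wp). Qed.

Let rho_low_conformal k n i j p : W p -> rho_low a b g k n i j p.1 p.2 =
  kapf p ^+ 2 * \sum_r \sum_s dy k (Zf r) p * dy n (Zf s) p *
   (Rlow af (fun k l => Rm k l i j) r s p + (h^-1 - 1) / (\sum_r Zf r p * zlow af Zf r p) *
     (zlow af Zf r p * wlow af Zf (fun k l => Rm k l i j) s p
      - wlow af Zf (fun k l => Rm k l i j) r p * zlow af Zf s p)).
Proof.
move=> Wp; rewrite rho_lowE //.
apply: (@conformal_covariant_derivative _ _ _ frame W af Zf (vf i j)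
  (fun q => kapf q ^+ 2) gf (fun k l => Rm k l i j) (h^-1 - 1)) => //.
- by move=> r s; exact: smooth_riemann_tensor.
- by move=> l q; exact: v_linear.
- by move=> m r q; exact: Rlow_skew.
Qed.

(** In the coordinates [Z] of the fibre the tensor [rho] is the Riemannian curvature
    plus a wedge product, and its square follows. *)
Lemma rho_square x y : U x -> qval a b x y != 0 ->
  \sum_k \sum_n \sum_i \sum_j
      rho_up a b g k n i j x y * rho_low a b g k n i j x y
  = \sum_k \sum_n \sum_i \sum_j
      riemann_up a x k n i j * riemann_low a x k n i j
    + 2 / S2val a b g x y * ((hpar g ^+ 2)^-1 - 1)
      * \sum_n \sum_i \sum_j
          (\sum_l zeta a b g l x y * riemann_mix a x l n i j)
          * (\sum_l zeta a b g l x y * riemann_low a x l n i j).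
Proof.
move=> Ux qn0; pose p : TX := (x, y).
have Wp : W p.
  split=> //; rewrite lt_neqAle; apply/andP; split.
    apply: contraNneq qn0 => E.
    by rewrite /qval -[X in Num.sqrt X]/(Q2 p) -E sqrtr0.
  rewrite leNgt; apply: contraNN qn0 => Q0.
  by rewrite /qval -[X in Num.sqrt X]/(Q2 p) ler0_sqrtr // ltW.
have RlE k n i j : riemann_low a x k n i j = Rlow af (fun k l => Rm k l i j) k n p.
  by apply: eq_bigr => m _; rewrite (riemannE _ _ _ _ p).
have S2E : S2val a b g x y = \sum_r Zf r p * zlow af Zf r p.
  apply: eq_bigr => r _; rewrite mulr_sumr; apply: eq_bigr => s _.
  by rewrite mulrAC mulrC.
have wE s i j : wlow af Zf (fun k l => Rm k l i j) s p =
    \sum_m Zf m p * riemann_low a x m s i j.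
  by rewrite wlowE; apply: eq_bigr => m _; rewrite RlE.
have XE k n i j : rho_low a b g k n i j x y = kapf p ^+ 2 * \sum_r \sum_s
    Pmx p r k * Pmx p s n * (riemann_low a x r s i j +
      (h^-1 - 1) / (\sum_r Zf r p * \sum_s A p r s * Zf s p) *
      ((\sum_t A p r t * Zf t p) * (\sum_m Zf m p * riemann_low a x m s i j)
       - (\sum_m Zf m p * riemann_low a x m r i j) * (\sum_t A p s t * Zf t p))).
  rewrite (rho_low_conformal k n i j Wp); congr (_ * _); apply: eq_bigr => r _.
  by apply: eq_bigr => s _; rewrite !mxE RlE !wE.
have skew k n i j : riemann_low a x k n i j = - riemann_low a x n k i j.
  by rewrite !RlE; exact: Rlow_skew.
have := conformal_square (a_unit Ux) (a_tr Ux) (Pmx_unit Wp) (kap2_neq0 Wp)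
  (S2_neq0 Wp) skew XE.
rewrite /= -(gmet_pullback Wp) S2E (_ : 1 + (h^-1 - 1) = h^-1); last by ring.
by rewrite exprVn.
Qed.

End Assembly.

Theorem mainTheorem14 (R : realType) (N : nat) (M : smoothManifold R N)
    (a : chart R N M -> 'rV[R]_N -> 'M[R]_N)
    (b : chart R N M -> 'rV[R]_N -> 'rV[R]_N) (g : R)
    (a_metric : riemannian_metric a) (b_form : one_form b)
    (b_unit : forall c, atlas c -> forall x, chart_img c x ->
       unit_length (a c) (b c) x)
    (g_bounds : -2 < g < 2)
    (c : chart R N M) (c_atlas : atlas c)
    (x : 'rV[R]_N) (x_img : chart_img c x)
    (y : 'rV[R]_N) (y_neq0 : y != 0) (q_neq0 : qval (a c) (b c) x y != 0) :
  \sum_k \sum_n \sum_i \sum_j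
      rho_up (a c) (b c) g k n i j x y * rho_low (a c) (b c) g k n i j x y
  = \sum_k \sum_n \sum_i \sum_j
      riemann_up (a c) x k n i j * riemann_low (a c) x k n i j
    + 2 / S2val (a c) (b c) g x y * ((hpar g ^+ 2)^-1 - 1)
      * \sum_n \sum_i \sum_j
          (\sum_l zeta (a c) (b c) g l x y * riemann_mix (a c) x l n i j)
          * (\sum_l zeta (a c) (b c) g l x y * riemann_low (a c) x l n i j).
Proof.
have oU : open (chart_img c) by case: (atlas_charts c_atlas).
exact: (rho_square oU g_bounds (metric_smooth a_metric c_atlas)
  (form_smooth b_form c_atlas) (metric_symmetric a_metric c_atlas)
  (metric_positive a_metric c_atlas) (b_unit c c_atlas) x_img q_neq0).
Qed.
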